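(* Let $\Omega$ be a nonempty open subset of $\mathbb{R}^N$, $p\in(1,+\infty)$, $\omega$ an admissible weight function in $\Omega$, and $p\le q<+\infty$. Let $F:L^q(\Omega)\to[-\infty,+\infty]$ be proper, bounded from below, convex, lower semicontinuous with respect to the $L^q(\Omega)$ norm, and such that $F(u)\to+\infty$ as $\|u\|_{L^q(\Omega)}\to+\infty$. Let $$I^p_\omega(u):=\int_{\Omega\times\Omega}|\nabla_\omega u|^p\,\mathrm{d}x\,\mathrm{d}y+F(u),\qquad u\in W^{1,p}_\omega(\Omega)\cap L^q(\Omega).$$ If $q>p$, assume furthermore that $\Omega$ is of finite measure. Then there exists $u_{*,p}\in W^{1,p}_\omega(\Omega)\cap L^q(\Omega)$ such that $$I^p_\omega(u_{*,p})=m_{*,p}:=\inf_{u\in W^{1,p}_\omega(\Omega)\cap L^q(\Omega)}I^p_\omega(u).$$ Moreover, if $F$ is strictly convex then the minimizer is unique.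
   Context: An admissible weight function in $\Omega$ is a function $\omega:\Omega\times\Omega\to[0,+\infty)$ belonging to $\mathcal{C}^1(\Omega\times\Omega)$ with $\omega(x,y)=\omega(y,x)$ for all $(x,y)$. For $\psi\in\mathcal{C}^1_c(\Omega\times\Omega)$ and $i=1,\dots,N$ put $$\partial^*_{\omega,i}(\psi)(x):=\int_\Omega\frac{\partial}{\partial x_i}\left[\omega(x,y)(\psi(y,x)-\psi(x,y))\right]\mathrm{d}y,\quad x\in\Omega.$$ A function $u\in L^1_{\mathrm{loc}}(\Omega)$ has weak $i$-th nonlocal partial derivative $\partial_{\omega,i}u\in L^1_{\mathrm{loc}}(\Omega\times\Omega)$ if $$\int_\Omega u(x)\,\partial^*_{\omega,i}(\psi)(x)\,\mathrm{d}x=-\int_{\Omega\times\Omega}\partial_{\omega,i}u(x,y)\,\psi(x,y)\,\mathrm{d}x\,\mathrm{d}y\quad\text{for all }\psi\in\mathcal{C}^1_c(\Omega\times\Omega);$$ it is unique a.e. Put $\nabla_\omega u:=(\partial_{\omega,1}u,\dots,\partial_{\omega,N}u)$, with $|\nabla_\omega u|$ its pointwise Euclidean norm, and $W^{1,p}_\omega(\Omega):=\{u\in L^p(\Omega):\nabla_\omega u\in L^p(\Omega\times\Omega;\mathbb{R}^N)\}$. *)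

(* Defs.v *)
From HB Require Import structures.
From mathcomp Require Import all_boot all_order all_algebra.
From mathcomp Require Import all_classical all_reals all_analysis measurable_realfun.
Set Implicit Arguments.
Unset Strict Implicit.
Unset Printing Implicit Defensive.
Import Order.TTheory GRing.Theory Num.Theory.
Import numFieldNormedType.Exports.
Local Open Scope classical_set_scope.
Local Open Scope ring_scope.

(* The product sigma-algebra on R^n (equal to the Borel one, see
   [open_measurable_rV]), in the way the library does it for n-tuples. *)
Section measurable_rV.
Context {R : realType} {n : nat}.

Let coord (i : 'I_n) (v : 'rV[R]_n) : R := v ord0 i.

Let rV_set0 : g_sigma_preimage coord set0.
Proof. exact: sigma_algebra0. Qed.

Let rV_setC A : g_sigma_preimage coord A -> g_sigma_preimage coord (~` A).
Proof. exact: sigma_algebraC. Qed.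

Let rV_bigcup (F : (set 'rV[R]_n)^nat) :
  (forall i, g_sigma_preimage coord (F i)) ->
  g_sigma_preimage coord (\bigcup_i (F i)).
Proof. exact: sigma_algebra_bigcup. Qed.

HB.instance Definition _ := @isMeasurable.Build default_measure_display
  'rV[R]_n (g_sigma_preimage coord) rV_set0 rV_setC rV_bigcup.

Lemma measurable_coord (i : 'I_n) :
  measurable_fun [set: 'rV[R]_n] (fun v : 'rV[R]_n => v ord0 i).
Proof.
move=> _ Y mY; rewrite setTI; apply: sub_sigma_algebra => /=.
rewrite -bigcup_seq/=; exists i => /=; first by rewrite mem_index_enum.
by exists Y => //; rewrite setTI.
Qed.

Lemma measurable_fun_rVP d (T : measurableType d) (f : T -> 'rV[R]_n) :
  (forall i, measurable_fun [set: T] (fun t => f t ord0 i)) ->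
  measurable_fun [set: T] f.
Proof.
move=> mf; apply: (@measurability _ _ _ _ _ _
  (\big[setU/set0]_(i < n) preimage_set_system setT (coord i) measurable)) => //.
move=> _ [B + <-]; rewrite -bigcup_seq => -[i _ [C mC <-]].
rewrite !setTI -comp_preimage -[X in measurable X]setTI.
exact: mf.
Qed.

Lemma open_measurable_rV (A : set 'rV[R]_n) : open A -> measurable A.
Proof.
move=> oA.
pose c (a : 'rV[rat]_n) : 'rV[R]_n := map_mx ratr a.
pose B (ak : 'rV[rat]_n * nat) : set 'rV[R]_n := ball (c ak.1) (ak.2.+1%:R^-1).
have -> : A = \bigcup_(ak in [set ak | B ak `<=` A]) B ak.
  apply/seteqP; split => [x Ax|x [ak BA]]; last exact: BA.
  have /nbhs_ballP[e /= e0 eA] : nbhs x A by exact: open_nbhs_nbhs.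
  have [k ke] : exists k : nat, k.+1%:R^-1 < e / 2.
    have := near_infty_natSinv_lt (PosNum (divr_gt0 e0 (ltr0n R 2))).
    by case=> k _ /(_ _ (leqnn k)) ?; exists k.
  have k0 : 0 < k.+1%:R^-1 :> R by rewrite invr_gt0.
  have /choice[a aP] : forall i : 'I_n, exists a : rat,
      `|x ord0 i - ratr a| < k.+1%:R^-1.
    move=> i.
    have [|a] := @rat_in_itvoo R (x ord0 i - k.+1%:R^-1) (x ord0 i + k.+1%:R^-1).
      by rewrite ltrD2l gtrN.
    by rewrite in_itv/= -ltr_distl distrC => ?; exists a.
  exists (\row_i a i, k); last first.
    split => // i j; rewrite /c !mxE (ord1 i).
    by rewrite /ball/= distrC; exact: aP.
  move=> y [_ yB]; apply: eA; split => // i j.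
  have := yB i j; rewrite /c !mxE (ord1 i) /ball/= => h.
  rewrite -(subrK (ratr (a j)) (x ord0 j)) -addrA (splitr e).
  by rewrite (le_lt_trans (ler_normD _ _))// ltrD// (lt_trans _ ke)//.
rewrite bigcup_mkcond; apply: countable_bigcupT_measurable => // -[a k].
case: ifP => // _.
rewrite [X in measurable X](_ : _ =
   \bigcap_(i in [set: 'I_n]) (fun v : 'rV[R]_n => v ord0 i) @^-1`
      (ball (c a ord0 i) (k.+1%:R^-1) : set R)); last first.
  apply/seteqP; split => [x [_ h] i _|x h]; first exact: h.
  by split => [|i j]; [rewrite invr_gt0|rewrite (ord1 i); exact: h].
apply: fin_bigcap_measurable => // i _.
rewrite -[X in measurable X]setTI; apply: measurable_coord => //.
exact: measurable_ball.
Qed.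

End measurable_rV.

Section lebesgue_rV.
Context {R : realType}.
Local Open Scope ereal_scope.

Definition cons_rV n (xv : R * 'rV[R]_n) : 'rV[R]_n.+1 :=
  row_mx (xv.1)%:M xv.2.

Lemma measurable_cons_rV n :
  measurable_fun [set: R * 'rV[R]_n] (@cons_rV n).
Proof.
apply: measurable_fun_rVP => i.
have [j ->|j ->] := split_ordP (i : 'I_(1 + n)).
- rewrite (_ : (fun _ => _) = fst)//; apply/funext => xv.
  by rewrite /cons_rV (row_mxEl (xv.1)%:M) (ord1 j) mxE eqxx mulr1n.
- rewrite (_ : (fun _ => _) = (fun v : 'rV[R]_n => v ord0 j) \o snd).
    by apply: measurableT_comp => //; exact: measurable_coord.
  by apply/funext => xv; rewrite /cons_rV (row_mxEr (xv.1)%:M).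
Qed.

Section step.
Context {n : nat} (mu : {sigma_finite_measure set 'rV[R]_n -> \bar R}).

Definition lebesgue_cons (A : set 'rV[R]_n.+1) : \bar R :=
  pushforward (@lebesgue_measure R \x mu) (@cons_rV n) A.

Let lebesgue_cons0 : lebesgue_cons set0 = 0.
Proof. by rewrite /lebesgue_cons /pushforward preimage_set0 measure0. Qed.

Let lebesgue_cons_ge0 A : 0 <= lebesgue_cons A.
Proof. by rewrite /lebesgue_cons /pushforward measure_ge0. Qed.

Let lebesgue_cons_sigma_additive : semi_sigma_additive lebesgue_cons.
Proof.
have mc A : measurable A -> measurable (@cons_rV n @^-1` A).
  by move=> mA; rewrite -[X in measurable X]setTI; exact: measurable_cons_rV.
move=> F mF tF mUF; rewrite /lebesgue_cons /pushforward preimage_bigcup.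
apply: measure_semi_sigma_additive.
- by move=> i; exact: mc.
- apply/trivIsetP => /= i j _ _ ij; rewrite -preimage_setI.
  by move/trivIsetP : tF => /(_ _ _ _ _ ij) ->//; rewrite preimage_set0.
- by rewrite -preimage_bigcup; exact: mc.
Qed.

HB.instance Definition _ := isMeasure.Build _ _ _ lebesgue_cons
  lebesgue_cons0 lebesgue_cons_ge0 lebesgue_cons_sigma_additive.

Let lebesgue_cons_sigma_finite : sigma_finite setT lebesgue_cons.
Proof.
have /sigma_finiteP[F [TF ndF Foo]] := sigma_finiteT (@lebesgue_measure R).
have /sigma_finiteP[G [TG ndG Goo]] := sigma_finiteT mu.
pose tl (v : 'rV[R]_n.+1) : R * 'rV[R]_n :=
  (v ord0 ord0, \row_j v ord0 (lift ord0 j)).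
have mtl : measurable_fun [set: 'rV[R]_n.+1] tl.
  apply/measurable_fun_pairP; split; first exact: measurable_coord.
  apply: measurable_fun_rVP => i.
  rewrite (_ : (fun _ => _) = fun v : 'rV[R]_n.+1 => v ord0 (lift ord0 i)).
    exact: measurable_coord.
  by apply/funext => v; rewrite mxE.
have consK : cancel (@cons_rV n) tl.
  move=> [x v]; congr (_, _).
    have -> : ord0 = lshift n (ord0 : 'I_1) :> 'I_n.+1 by exact/val_inj.
    rewrite /cons_rV /=.
    by rewrite (row_mxEl x%:M) mxE eqxx mulr1n.
  apply/rowP => j; rewrite mxE.
  have -> : lift ord0 j = rshift 1 j :> 'I_n.+1 by exact/val_inj.
  rewrite /cons_rV /=.
  by rewrite (row_mxEr x%:M).
exists (fun k => tl @^-1` (F k `*` G k)).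
  rewrite -preimage_bigcup (_ : \bigcup_k (F k `*` G k) = setT) ?preimage_setT//.
  rewrite -setXTT TF TG predeqE => -[x y]; split.
    by move=> [k _ [? ?]]; split; exists k.
  move=> [/= [i _ Fi] [j _ Gj]]; exists (maxn i j) => //; split => /=.
  - by move: x Fi; exact/subsetPset/ndF/leq_maxl.
  - by move: y Gj; exact/subsetPset/ndG/leq_maxr.
move=> k; have [mF Ffin] := Foo k; have [mG Gfin] := Goo k; split.
  by rewrite -[X in measurable X]setTI; apply: mtl => //; exact: measurableX.
rewrite /lebesgue_cons /pushforward -comp_preimage.
rewrite (_ : tl \o _ = id); last by apply/funext => x; exact: consK.
by rewrite preimage_id product_measure1E// lte_mul_pinfty// ge0_fin_numE.
Qed.

HB.instance Definition _ := Measure_isSigmaFinite.Build _ _ _ lebesgue_cons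
  lebesgue_cons_sigma_finite.

End step.

Fixpoint lebesgue_rV n : {sigma_finite_measure set 'rV[R]_n -> \bar R} :=
  if n is m.+1 then lebesgue_cons (lebesgue_rV m) else \d_(0 : 'rV[R]_0)%R.

Lemma lebesgue_rV_box n (A : 'I_n -> set R) : (forall i, measurable (A i)) ->
  lebesgue_rV n [set v | forall i, A i (v ord0 i)] =
  \prod_(i < n) lebesgue_measure (A i).
Proof.
elim: n A => [|n IH] A mA.
  by rewrite big_ord0 /= diracE mem_set// => -[].
rewrite big_ord_recl /= -IH//.
have mB : measurable
    [set v : 'rV[R]_n | forall i, A (lift ord0 i) (v ord0 i)].
  rewrite (_ : mkset _ = \bigcap_(i in [set: 'I_n])
      (fun v : 'rV[R]_n => v ord0 i) @^-1` A (lift ord0 i)).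
    apply: fin_bigcap_measurable => // i _; rewrite -[X in measurable X]setTI.
    exact: measurable_coord.
  by apply/seteqP; split => v h i; [move=> _; exact: h|exact: h].
rewrite -product_measure1E//; last exact: (mA ord0).
rewrite /lebesgue_cons /pushforward.
set S := _ @^-1` _; set P := _ `*` _; suff -> : S = P by []; rewrite {}/S {}/P.
have E0 : ord0 = lshift n (ord0 : 'I_1) :> 'I_n.+1 by exact/val_inj.
have EL (j : 'I_n) : lift ord0 j = rshift 1 j :> 'I_n.+1 by exact/val_inj.
apply/seteqP; split => -[x v] /=.
- move=> h; split => [|j] /=.
  + by have := h ord0; rewrite /cons_rV E0 (row_mxEl x%:M) mxE eqxx mulr1n.
  + by have := h (lift ord0 j); rewrite /cons_rV EL (row_mxEr x%:M).
- move=> [Ax Av] i; have [j ->|j ->] := split_ordP (i : 'I_(1 + n)).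
  + rewrite /cons_rV (row_mxEl x%:M) (ord1 j) mxE eqxx mulr1n.
    by rewrite -E0.
  + by rewrite /cons_rV (row_mxEr x%:M) -EL; exact: Av.
Qed.

End lebesgue_rV.

Section nonlocal_gradient.
Context {R : realType} {N : nat}.
Implicit Types (Omega : set 'rV[R]_N) (u : 'rV[R]_N -> R)
  (omega g psi : 'rV[R]_N * 'rV[R]_N -> R).

Local Notation lambda := (lebesgue_rV N : {measure set 'rV[R]_N -> \bar R}).
Local Notation lambda2 := (lebesgue_rV N \x lebesgue_rV N)%E.

(* Meant for open [A] and finite-dimensional [V], where continuity of
   [z |-> 'd f z v] for every [v] is continuity of [z |-> 'd f z]. *)
Definition C1_on (V : normedModType R) (A : set V) (f : V -> R) : Prop :=
  forall z, A z -> differentiable f z /\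
    forall v, {for z, continuous (fun z' => 'd f z' v)}.

(* Only the values of [omega] on [Omega `*` Omega] are relevant. *)
Definition admissible_weight Omega omega : Prop :=
  [/\ forall x y, Omega x -> Omega y -> 0 <= omega (x, y),
      C1_on (Omega `*` Omega) omega &
      forall x y, Omega x -> Omega y -> omega (x, y) = omega (y, x)].

(* [C^1_c(Omega x Omega)], each function being extended by 0. *)
Definition C1c Omega psi : Prop :=
  let supp := closure [set z | psi z != 0] in
  [/\ C1_on (Omega `*` Omega) psi, compact supp & supp `<=` Omega `*` Omega].

Definition nl_partial_adjoint Omega omega (i : 'I_N) psi (x : 'rV[R]_N) : R :=
  \int[lambda]_(y in Omega)
    'D_(delta_mx 0 i) (fun x' => omega (x', y) * (psi (y, x') - psi (x', y))) x.

Definition L1loc Omega u : Prop :=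
  measurable_fun Omega u /\
  forall K, compact K -> K `<=` Omega -> lambda.-integrable K (EFin \o u).

Definition L1loc2 Omega g : Prop :=
  measurable_fun (Omega `*` Omega) g /\
  forall K, compact K -> K `<=` Omega `*` Omega ->
    lambda2.-integrable K (EFin \o g).

Definition is_nl_partial Omega omega (i : 'I_N) u g : Prop :=
  [/\ L1loc Omega u, L1loc2 Omega g & forall psi, C1c Omega psi ->
    \int[lambda]_(x in Omega) (u x * nl_partial_adjoint Omega omega i psi x) =
    - \int[lambda2]_(z in Omega `*` Omega) (g z * psi z)].

(* A representative of the weak derivative, or 0 if there is none. *)
Definition nl_partial Omega omega (i : 'I_N) u : 'rV[R]_N * 'rV[R]_N -> R :=
  xget (cst 0) [set g | is_nl_partial Omega omega i u g].

Definition nl_grad_norm Omega omega u (z : 'rV[R]_N * 'rV[R]_N) : R :=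
  Num.sqrt (\sum_(i < N) nl_partial Omega omega i u z ^+ 2).

Definition nl_dirichlet Omega omega (p : R) u : \bar R :=
  (\int[lambda2]_(z in Omega `*` Omega)
     (nl_grad_norm Omega omega u z `^ p)%:E)%E.

Definition lebesgue_on Omega (oOmega : open Omega) :
    {measure set 'rV[R]_N -> \bar R} :=
  mrestr lambda (open_measurable_rV oOmega).

(* Functions are defined on the whole of R^N, but [lebesgue_on] does not see
   their values outside [Omega]. *)
Definition W1p Omega (oOmega : open Omega) omega (p : R) : set ('rV[R]_N -> R) :=
  [set u | [/\ u \in Lfun (lebesgue_on oOmega) p%:E,
    forall i, exists g, is_nl_partial Omega omega i u g &
    (nl_dirichlet Omega omega p u < +oo)%E]].

End nonlocal_gradient.

Lemma exponent_ge1 (R : realType) (p q : R) :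
  1 < p -> p <= q -> (1 <= q%:E)%E.
Proof. by move=> p1 pq; rewrite lee_fin (le_trans (ltW p1)). Qed.

(* A function on the space L^q is represented by a function on [LfunType] (whose
   elements are functions, not classes) that is compatible with a.e. equality. *)
Section functionals_on_Lq.
Context d (T : measurableType d) {R : realType}.
Context (mu : {measure set T -> \bar R}) {q : \bar R} {q1 : (1 <= q)%E}.
Local Open Scope ereal_scope.
Variable F : LfunType mu q1 -> \bar R.
Implicit Types u v : LfunType mu q1.

Definition ae_compatible : Prop :=
  forall u v, u = v %[ae mu] -> F u = F v.

Definition proper_functional : Prop :=
  (forall u, -oo < F u) /\ (exists u, F u < +oo).

Definition bounded_below : Prop :=
  exists c : R, forall u, c%:E <= F u.

(* In [\bar R], [+oo + -oo = -oo] and [0 * +oo = 0]; no sum [+oo + -oo] arises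
   when [F] is proper. *)
Definition convex_functional : Prop :=
  forall u v (t : R), (0 <= t <= 1)%R ->
    F (t *: u + (1 - t) *: v)%R <= t%:E * F u + (1 - t)%:E * F v.

Definition strictly_convex_functional : Prop :=
  forall u v (t : R), (0 < t < 1)%R -> ~ (u = v %[ae mu]) ->
    F (t *: u + (1 - t) *: v)%R < t%:E * F u + (1 - t)%:E * F v.

(* [strictly_convex_functional] forces [F < +oo] everywhere on a nontrivial
   space; this variant does not. *)
Definition strictly_convex_on_domain : Prop :=
  forall u v (t : R), (0 < t < 1)%R -> ~ (u = v %[ae mu]) ->
    F u < +oo -> F v < +oo ->
    F (t *: u + (1 - t) *: v)%R < t%:E * F u + (1 - t)%:E * F v.

Definition norm_lsc : Prop :=
  forall u (a : R), a%:E < F u -> exists2 delta : R, (0 < delta)%R &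
    forall v, 'N[mu]_q[EFin \o (v - u)%R] < delta%:E -> a%:E < F v.

Definition coercive_functional : Prop :=
  forall M : R, exists K : R, forall u,
    K%:E < 'N[mu]_q[EFin \o u] -> M%:E < F u.

End functionals_on_Lq.

Section minimization.
Context {R : realType} {N : nat} (Omega : set 'rV[R]_N) (oOmega : open Omega).
Context (omega : 'rV[R]_N * 'rV[R]_N -> R) (p : R).
Context {q : \bar R} {q1 : (1 <= q)%E}.
Local Notation Lq := (LfunType (lebesgue_on oOmega) q1).
Local Open Scope ereal_scope.
Variable F : Lq -> \bar R.

(* [W^{1,p}_omega(Omega)] intersected with [L^q(Omega)] *)
Definition W1p_Lq : set Lq := [set u | W1p oOmega omega p u].

Definition I_functional (u : Lq) : \bar R :=
  nl_dirichlet Omega omega p u + F u.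

Definition I_inf : \bar R := ereal_inf (I_functional @` W1p_Lq).

Definition is_minimizer (u : Lq) : Prop :=
  W1p_Lq u /\ I_functional u = I_inf.

End minimization.

(* Main.v *)
Require Import Defs.
From HB Require Import structures.
From mathcomp Require Import all_boot all_order all_algebra.
From mathcomp Require Import all_classical all_reals all_analysis.
From mathcomp Require Import ring lra measurable_realfun.
Set Implicit Arguments.
Unset Strict Implicit.
Unset Printing Implicit Defensive.
Import Order.TTheory GRing.Theory Num.Theory.
Import numFieldNormedType.Exports.
Local Open Scope classical_set_scope.
Local Open Scope ring_scope.

(** The existence proof is the direct method of the calculus of variations,
    with weak compactness replaced by uniform convexity, so that all
    convergences are strong.

    Write I = D + F, with D the Dirichlet energy, let m be the infimum of I,
    assumed finite (otherwise 0 is a minimizer), and let C_n be the set of the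
    u with I(u) <= m + 1/(n+1). These sets are convex, decrease with n, and by
    coercivity of F and its lower bound they are bounded in L^q and in energy.
    Choose u_n in C_n whose L^q norm is nearly minimal in C_n
    (nested_minimizing). For n <= k the midpoint of u_n and u_k lies in C_n,
    so its norm is not much smaller than theirs, and the uniform convexity of
    L^q makes (u_n) a Cauchy sequence. The gradients are Cauchy in L^p for a
    similar reason: I is at least m at the midpoint and F is convex, so the
    midpoint gains almost nothing in D (near_minimizers_mid). Both cases use
    one uniform convexity statement, Lp_uniformly_convex, which is the
    integral of the pointwise inequality enorm_powR_uniformly_convex, itself a
    compactness argument.

    A subsequence with prescribed rates converges almost everywhere and in
    norm (Lp_rapid_cauchy_cvg). The weak nonlocal derivative is closed under
    such limits (is_nl_partial_closed), because a test function and its image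
    under the adjoint operator are bounded, measurable and supported in
    compact sets. Lower semicontinuity of F and Fatou's lemma for D then show
    that the limit is a minimizer (minimizer_exists_finite).

    The energy D is defined through a chosen representative of the weak
    gradient, so even its value at a midpoint requires that weak derivatives
    be unique. This is is_nl_partial_unique, a consequence of the fundamental
    lemma of the calculus of variations: smooth enough bumps approximate
    indicator functions of boxes, and a pi-lambda argument passes from boxes
    to measurable sets.

    Uniqueness of the minimizer compares two minimizers with their midpoint, D
    being convex and F strictly convex (minimizer_unique). *)

(** * Strict convexity of powers of the Euclidean norm *)

Section pointwise.
Context {R : realType}.
Implicit Types (p s t : R).

(** The absolute value matters: x `^ p is 1 for negative x, so powR itself
    jumps at 0. *)
Lemma continuous_norm_powR p : 0 < p -> continuous (fun x : R => `|x| `^ p).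
Proof.
move=> p0 x; have [->|x0] := eqVneq x 0.
  apply/cvgrPdist_lt => e e0; rewrite normr0 powR0 ?gt_eqF//.
  near=> y; rewrite sub0r normrN (ger0_norm (powR_ge0 _ _)).
  have ye : `|y| < e `^ p^-1.
    near: y; apply: (@nbhs0_lt _ R^o); exact: powR_gt0.
  have -> : e = (e `^ p^-1) `^ p.
    by rewrite -powRrM mulVf ?gt_eqF// powRr1// ltW.
  by rewrite gt0_ltr_powR// nnegrE powR_ge0.
apply: (@continuous_comp _ _ _ (fun x : R => `|x|) (fun y => y `^ p)).
  exact: norm_continuous.
apply: differentiable_continuous; apply/derivable1_diffP.
by apply: derivable_powR; rewrite in_itv/= andbT normr_gt0.
Unshelve. all: by end_near. Qed.

(** Mean value theorem on the two halves of the interval: the slope is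
    strictly larger on the right half. *)
Lemma powR_midpoint_lt p s t : 1 < p -> 0 <= s -> s < t ->
  ((s + t) / 2) `^ p < (s `^ p + t `^ p) / 2.
Proof.
move=> p1 s0 st; set m := (s + t) / 2.
have p0 : 0 < p by lra.
have [sm mt] : s < m /\ m < t by rewrite /m; split; lra.
have df (x : R) : 0 < x -> is_derive x 1 (@powR R ^~ p) (p * x `^ (p - 1)).
  by move=> x0; exact: is_derive1_powR.
have cf (a b : R) : 0 <= a -> {within `[a, b], continuous (@powR R ^~ p)}.
  move=> a0; apply: (@subspace_eq_continuous _ _ _ (fun x => `|x| `^ p)).
    move=> x; rewrite inE/= in_itv/= => /andP[ax _].
    by rewrite ger0_norm// (le_trans a0).
  exact/continuous_subspaceT/continuous_norm_powR.
pose f' (x : R) := p * x `^ (p - 1).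
have [||c /[!in_itv]/= /andP[sc cm] c1] := @MVT _ (@powR R ^~ p) f' s m sm.
- by move=> x /[!in_itv]/= /andP[sx _]; apply: df; lra.
- exact: cf.
have [||d /[!in_itv]/= /andP[md dt] d1] := @MVT _ (@powR R ^~ p) f' m t mt.
- by move=> x /[!in_itv]/= /andP[mx _]; apply: df; lra.
- by apply: cf; lra.
have : p * c `^ (p - 1) < p * d `^ (p - 1).
  rewrite ltr_pM2l// gt0_ltr_powR ?nnegrE; lra.
rewrite -(@ltr_pM2r _ (m - s)); last lra.
rewrite -c1; rewrite (_ : m - s = t - m) -?d1; last by rewrite /m; lra.
move: (s `^ p) (t `^ p) (m `^ p) => A B C; lra.
Qed.

Context {n : nat}.
Implicit Types a b : 'rV[R]_n.

Definition enorm a : R := Num.sqrt (\sum_i a ord0 i ^+ 2).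

Lemma enorm_ge0 a : 0 <= enorm a. Proof. exact: sqrtr_ge0. Qed.

Lemma sumr_sqr_ge0 a : 0 <= \sum_i a ord0 i ^+ 2.
Proof. by apply: sumr_ge0 => i _; exact: sqr_ge0. Qed.

Lemma enorm_sqr a : enorm a ^+ 2 = \sum_i a ord0 i ^+ 2.
Proof. by rewrite sqr_sqrtr// sumr_sqr_ge0. Qed.

Lemma coord_le_enorm a i : `|a ord0 i| <= enorm a.
Proof.
rewrite -sqrtr_sqr ler_sqrt ?sumr_sqr_ge0//.
by rewrite (bigD1 i)//= lerDl sumr_ge0// => j _; exact: sqr_ge0.
Qed.

Lemma enorm_eq0 a : (enorm a == 0) = (a == 0).
Proof.
apply/eqP/eqP => [a0|->].
  apply/rowP => i; apply/eqP; rewrite mxE -normr_le0 -a0; exact: coord_le_enorm.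
by rewrite /enorm big1 ?sqrtr0// => i _; rewrite mxE expr0n.
Qed.

Lemma enormZ k a : enorm (k *: a) = `|k| * enorm a.
Proof.
rewrite /enorm -sqrtr_sqr -sqrtrM ?sqr_ge0// mulr_sumr.
by congr Num.sqrt; apply: eq_bigr => i _; rewrite mxE exprMn.
Qed.

(** Cauchy-Schwarz: x * y <= (x ^+ 2 + y ^+ 2) / 2 summed over the
    coordinates of the normalized vectors. *)
Lemma sumr_mul_le_enorm a b : \sum_i a ord0 i * b ord0 i <= enorm a * enorm b.
Proof.
have [|a0] := eqVneq (enorm a) 0.
  move=> /eqP; rewrite enorm_eq0 => /eqP ->;
      rewrite big1 ?mulr_ge0 ?enorm_ge0//.
  by move=> i _; rewrite mxE mul0r.
have [|b0] := eqVneq (enorm b) 0.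
  move=> /eqP; rewrite enorm_eq0 => /eqP ->;
      rewrite big1 ?mulr_ge0 ?enorm_ge0//.
  by move=> i _; rewrite mxE mulr0.
have A0 : 0 < enorm a by rewrite lt0r a0 enorm_ge0.
have B0 : 0 < enorm b by rewrite lt0r b0 enorm_ge0.
rewrite -[leRHS]mul1r -ler_pdivrMr ?mulr_gt0// mulr_suml.
apply: (@le_trans _ _ (\sum_i (2^-1 * (enorm a ^- 2 * a ord0 i ^+ 2)
    + 2^-1 * (enorm b ^- 2 * b ord0 i ^+ 2)))).
  apply: ler_sum => i _; rewrite -!exprVn -!exprMn.
  set x := _^-1 * a ord0 i; set y := (enorm b)^-1 * _.
  have -> : a ord0 i * b ord0 i / (enorm a * enorm b) = x * y.
    by rewrite invfM /x /y; ring.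
  have := sqr_ge0 (x - y); nra.
rewrite big_split/= -!mulr_sumr -!enorm_sqr !mulVf ?expf_neq0//; lra.
Qed.

Lemma enorm_mid_sqr a b :
  enorm (2^-1 *: (a + b)) ^+ 2 =
  (enorm a ^+ 2 + enorm b ^+ 2) / 2 - (enorm (a - b) / 2) ^+ 2.
Proof.
rewrite exprMn !enorm_sqr -big_split/= !mulr_suml -sumrB.
by apply: eq_bigr => i _; rewrite !mxE; lra.
Qed.

Lemma enorm_mid_le a b : enorm (2^-1 *: (a + b)) <= (enorm a + enorm b) / 2.
Proof.
rewrite -ler_sqr ?nnegrE ?enorm_ge0 ?divr_ge0 ?addr_ge0 ?enorm_ge0//.
have -> : enorm (2^-1 *: (a + b)) ^+ 2 = (enorm a ^+ 2 + enorm b ^+ 2) / 4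
    + (\sum_i a ord0 i * b ord0 i) / 2.
  rewrite !enorm_sqr -big_split/= !mulr_suml -big_split/=.
  by apply: eq_bigr => i _; rewrite !mxE; lra.
have := sumr_mul_le_enorm a b; lra.
Qed.

(** If the two norms differ, strictness comes from the strict convexity of
    the power; if they are equal, it comes from the parallelogram identity
    enorm_mid_sqr. *)
Lemma enorm_powR_mid_lt p a b : 1 < p -> a != b ->
  enorm (2^-1 *: (a + b)) `^ p < (enorm a `^ p + enorm b `^ p) / 2.
Proof.
move=> p1 ab; have p0 : 0 < p by lra.
have := enorm_mid_le a b; have := enorm_ge0 (2^-1 *: (a + b)).
have := enorm_ge0 a; have := enorm_ge0 b => B0 A0 M0 mid.
have [eab|neab] := eqVneq (enorm a) (enorm b).
  rewrite eab (_ : (_ + _) / 2 = enorm b `^ p); last by lra.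
  rewrite gt0_ltr_powR ?nnegrE//.
  rewrite -ltr_sqr ?nnegrE// enorm_mid_sqr eab.
  have : 0 < enorm (a - b) ^+ 2.
    by rewrite exprn_gt0// lt0r enorm_ge0 enorm_eq0 subr_eq0 ab.
  by rewrite exprMn; lra.
apply: (@le_lt_trans _ _ (((enorm a + enorm b) / 2) `^ p)).
  by rewrite ge0_ler_powR ?nnegrE// ?(ltW p0)//; lra.
have [st|ts|/eqP] := ltgtP (enorm a) (enorm b); last by rewrite (negbTE neab).
- exact: powR_midpoint_lt.
- by rewrite addrC (addrC (enorm a `^ p)); exact: powR_midpoint_lt.
Qed.

Lemma enorm_powR_mid_le p a b : 1 < p ->
  enorm (2^-1 *: (a + b)) `^ p <= (enorm a `^ p + enorm b `^ p) / 2.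
Proof.
move=> p1; have [->|ab] := eqVneq a b; last exact/ltW/enorm_powR_mid_lt.
rewrite (_ : 2^-1 *: (b + b) = b); first by lra.
by apply/rowP => i; rewrite !mxE; lra.
Qed.

Lemma continuous_enorm : continuous enorm.
Proof.
move=> a; apply: (@continuous_comp _ _ _ _ Num.sqrt);
    last exact: sqrt_continuous.
apply: (@continuous_big R _ +%R 0 xpredT add_continuous _ _
  (fun i (v : 'rV[R]_n) => v ord0 i ^+ 2)) => i _ {}a.
apply: (@continuous_comp _ _ _ (fun v : 'rV[R]_n => v ord0 i)
    (fun x : R => x ^+ 2)).
  exact: coord_continuous.
exact: exprn_continuous.
Qed.

Lemma continuous_enorm_powR p : 0 < p -> continuous (fun a => enorm a `^ p).
Proof.
move=> p0; have -> : (fun a => enorm a `^ p) =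
    (fun x : R => `|x| `^ p) \o enorm.
  by apply/funext => a /=; rewrite ger0_norm ?enorm_ge0.
by move=> a; apply: continuous_comp;
    [exact: continuous_enorm|exact: continuous_norm_powR].
Qed.

End pointwise.

(** * Uniform convexity of powers of the Euclidean norm *)

Section unif.
Context {R : realType} {n : nat}.
Implicit Types (a b : 'rV[R]_n) (p eps : R).

Let sphere p eps : set ('rV[R]_n * 'rV[R]_n) :=
  [set ab | enorm ab.1 `^ p + enorm ab.2 `^ p = 1 /\
            eps <= enorm (ab.1 - ab.2) `^ p].

Let cont_fst p : 0 < p -> continuous
    (fun ab : 'rV[R]_n * 'rV[R]_n => enorm ab.1 `^ p).
Proof.
move=> p0 ab; apply: (@continuous_comp _ _ _ fst
    (fun a : 'rV[R]_n => enorm a `^ p)).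
  exact: cvg_fst.
exact: continuous_enorm_powR.
Qed.

Let cont_snd p : 0 < p -> continuous
    (fun ab : 'rV[R]_n * 'rV[R]_n => enorm ab.2 `^ p).
Proof.
move=> p0 ab; apply: (@continuous_comp _ _ _ snd
    (fun a : 'rV[R]_n => enorm a `^ p)).
  exact: cvg_snd.
exact: continuous_enorm_powR.
Qed.

Let cont_sub p : 0 < p ->
  continuous (fun ab : 'rV[R]_n * 'rV[R]_n => enorm (ab.1 - ab.2) `^ p).
Proof.
move=> p0 ab; apply: (@continuous_comp _ _ _
    (fun ab : 'rV[R]_n * 'rV[R]_n => ab.1 - ab.2)
    (fun a : 'rV[R]_n => enorm a `^ p)).
  by apply: cvgB; [exact: cvg_fst|exact: cvg_snd].
exact: continuous_enorm_powR.
Qed.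

Let cont_mid p : 0 < p ->
  continuous (fun ab : 'rV[R]_n * 'rV[R]_n =>
      enorm (2^-1 *: (ab.1 + ab.2)) `^ p).
Proof.
move=> p0 ab; apply: (@continuous_comp _ _ _
    (fun ab : 'rV[R]_n * 'rV[R]_n => 2^-1 *: (ab.1 + ab.2))
    (fun a : 'rV[R]_n => enorm a `^ p)).
  by apply: cvgZr; apply: cvgD; [exact: cvg_fst|exact: cvg_snd].
exact: continuous_enorm_powR.
Qed.

Let compact_sphere p eps : 0 < p -> compact (sphere p eps).
Proof.
move=> p0.
pose B := [set v : 'rV[R]_n | forall i, `[-1, 1]%classic (v ord0 i)].
have cB : compact B.
  apply: (@rV_compact R n (fun=> `[-1, 1]%classic)) => _.
  exact: segment_compact.
apply: (@subclosed_compact _ _ (B `*` B)); last 2 first.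
- exact: compact_setX.
- have le1 (v : 'rV[R]_n) (y : R) : 0 <= y -> enorm v `^ p + y = 1 -> B v.
    move=> y0 vy i; rewrite /= in_itv/= -ler_norml.
    apply: (le_trans (coord_le_enorm v i)); rewrite leNgt; apply/negP => v1.
    have : 1 `^ p < enorm v `^ p by rewrite gt0_ltr_powR ?nnegrE ?enorm_ge0.
    by rewrite powR1 /= => h; move: vy y0 h; set z := _ `^ p; lra.
  move=> [a b] [/= ab _]; split => /=; first exact: le1 (powR_ge0 _ _) ab.
  by move: ab; rewrite addrC => /(le1 _ _ (powR_ge0 _ _)).
- apply: closedI.
    apply: (@preimage_closed _ _
        (fun ab : 'rV[R]_n * 'rV[R]_n => enorm ab.1 `^ p + enorm ab.2 `^ p)
        [set 1]); last exact: closed_eq.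
    by move=> ab _; apply: cvgD; [exact: cont_fst|exact: cont_snd].
  apply: (@preimage_closed _ _
      (fun ab : 'rV[R]_n * 'rV[R]_n => enorm (ab.1 - ab.2) `^ p)
      [set x | eps <= x]); last exact: closed_ge.
  by move=> ab _; exact: cont_sub.
Qed.

(** Up to a small multiple of the energy, the p-th power of the distance is
    controlled by the convexity defect. By homogeneity one may assume that
    the two p-th powers add up to 1; on the compact set of such pairs at
    distance at least eps (in p-th power) the defect is positive, hence
    bounded below by some d > 0, while the p-th power of the distance has a
    maximum M, and C = M / d works. This form, unlike a modulus of
    convexity, can be integrated directly. *)
Lemma enorm_powR_uniformly_convex p eps : 1 < p -> 0 < eps ->
  exists2 C, 0 <= C & forall a b,
    enorm (a - b) `^ p <= eps * (enorm a `^ p + enorm b `^ p) +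
      C * ((enorm a `^ p + enorm b `^ p) / 2 - enorm (2^-1 *: (a + b)) `^ p).
Proof.
move=> p1 e0; have p0 : 0 < p by lra.
suff [C C0 CP] : exists2 C, 0 <= C & forall a b,
    enorm a `^ p + enorm b `^ p = 1 -> enorm (a - b) `^ p <= eps +
      C * (2^-1 - enorm (2^-1 *: (a + b)) `^ p).
  exists C => // a b; set S := _ `^ p + _ `^ p.
  have S0 : 0 <= S by rewrite addr_ge0// powR_ge0.
  have [S00|Sneq0] := eqVneq S 0.
    have /eqP : S == 0 by apply/eqP.
    move/eqP; rewrite /S paddr_eq0 ?powR_ge0// !powR_eq0 !enorm_eq0.
    move=> /andP[/andP[/eqP -> _] /andP[/eqP -> _]].
    rewrite subr0 addr0 scaler0 (eqP (_ : enorm 0 == 0)) ?enorm_eq0//.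
    by rewrite powR0 ?gt_eqF//; lra.
  have {}S0 : 0 < S by rewrite lt0r Sneq0.
  (* The scaling that normalizes the pair: t `^ p = S^-1. *)
  pose t := S `^ (- p^-1).
  have t0 : 0 <= t by exact: powR_ge0.
  have tp : t `^ p = S^-1.
    by rewrite /t -powRrM mulNr mulVf ?gt_eqF// powR_inv1// ltW.
  have scale v : enorm (t *: v) `^ p = S^-1 * enorm v `^ p.
    by rewrite enormZ ger0_norm// powRM ?enorm_ge0// tp.
  have := CP (t *: a) (t *: b); rewrite !scale -mulrDr mulVf// => /(_ erefl).
  rewrite -scalerBr -scalerDr scalerA (mulrC 2^-1 t) -scalerA !scale.
  rewrite -(ler_pM2l S0) mulrA mulfV// mul1r => /le_trans; apply.
  set x := enorm (2^-1 *: (a + b)) `^ p.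
  by have -> : S * (eps + C * (2^-1 - S^-1 * x)) = eps * S +
      C * (S / 2 - x) by field.
have [K0|/set0P K0] := eqVneq (sphere p eps) set0.
  (* If no normalized pair is that far apart, any constant will do. *)
  exists 0 => // a b ab; rewrite mul0r addr0 leNgt; apply/negP => /ltW h.
  by have : sphere p eps (a, b) by []; rewrite K0.
pose h (ab : 'rV[R]_n * 'rV[R]_n) := 2^-1 - enorm (2^-1 *: (ab.1 + ab.2)) `^ p.
have ch : continuous h.
  by move=> ab; apply: cvgB; [exact: cvg_cst|exact: cont_mid].
have [[a0 b0] /set_mem[/= ab0 ab0e] min0] :=
  compact_EVT_min K0 (compact_sphere p0) (continuous_subspaceT ch).
have [[a1 b1]/= /set_mem[/= ab1 ab1e] max1] :=
    compact_EVT_max K0 (compact_sphere p0)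
  (continuous_subspaceT (cont_sub p0)).
set d := h _ in min0; set M := _ `^ p in max1.
have d0 : 0 < d.
  have ab : a0 != b0.
    apply: contraTN ab0e => /eqP ->.
    by rewrite subrr (eqP (_ : enorm 0 == 0)) ?enorm_eq0// powR0 ?gt_eqF//
        -ltNge.
  by have := enorm_powR_mid_lt p1 ab; rewrite ab0 /d /h /= subr_gt0 div1r.
have M0 : 0 <= M by exact: powR_ge0.
clearbody d M; exists (M / d) => [|a b ab]; first by rewrite divr_ge0// ltW.
have h0 := enorm_powR_mid_le a b p1; rewrite ab div1r in h0.
have [le|/ltW lt] := leP (enorm (a - b) `^ p) eps.
  apply: (le_trans le); rewrite lerDl; apply: mulr_ge0;
      first by rewrite divr_ge0// ltW.
  by rewrite subr_ge0.
have Kab : (a, b) \in sphere p eps by rewrite inE.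
have := max1 _ Kab; have := min0 _ Kab; rewrite /h /= => dle Mle.
apply: (le_trans Mle); rewrite -[leLHS]add0r lerD ?(ltW e0)//.
by rewrite -[leLHS]mulr1 -mulrA ler_wpM2l// mulrC ler_pdivlMr// mul1r.
Qed.

End unif.

(** * Uniform convexity of the p-energy *)

Lemma measurable_norm_powR d (T : measurableType d) (R : realType) (A : set T)
    (h : T -> R) (r : R) :
  measurable_fun A h -> measurable_fun A (fun x => `|h x| `^ r).
Proof.
move=> mh; apply: (measurableT_comp (f := fun x : R => x `^ r)).
  exact: measurable_powR.
exact: measurableT_comp.
Qed.

Section Lp_uniform_convexity.
Context d (T : measurableType d) (R : realType)
    (mu : {measure set T -> \bar R}).
Context (D : set T) (mD : measurable D).

Lemma ge0_integral_lincomb (f g : T -> R) (a b : R) :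
  measurable_fun D f -> measurable_fun D g ->
  (forall x, 0 <= f x) -> (forall x, 0 <= g x) -> 0 <= a -> 0 <= b ->
  (\int[mu]_(x in D) (a * f x + b * g x)%:E =
   a%:E * \int[mu]_(x in D) (f x)%:E + b%:E * \int[mu]_(x in D) (g x)%:E)%E.
Proof.
move=> mf mg f0 g0 a0 b0; under eq_integral do rewrite EFinD !EFinM.
rewrite ge0_integralD//; last 4 first.
- by move=> x _; rewrite lee_fin mulr_ge0.
- by apply/measurable_EFinP; exact: measurable_funM.
- by move=> x _; rewrite lee_fin mulr_ge0.
- by apply/measurable_EFinP; exact: measurable_funM.
rewrite !ge0_integralZl_EFin//;
    first [exact/measurable_EFinP|by move=> x _; rewrite lee_fin].
Qed.

Lemma ge0_le_integral_EFin (f g : T -> R) :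
  measurable_fun D f -> measurable_fun D g ->
  (forall x, D x -> 0 <= f x <= g x) ->
  (\int[mu]_(x in D) (f x)%:E <= \int[mu]_(x in D) (g x)%:E)%E.
Proof.
move=> mf mg fg; apply: ge0_le_integral => //; try exact/measurable_EFinP.
- by move=> x /fg /andP[]; rewrite lee_fin.
- by move=> x /fg /andP[_]; rewrite lee_fin.
Qed.

Context {n : nat}.
Implicit Types (f g : T -> 'rV[R]_n) (p : R).

Lemma measurable_enorm_powR f p :
  (forall i, measurable_fun D (fun x => f x ord0 i)) ->
  measurable_fun D (fun x => enorm (f x) `^ p).
Proof.
move=> mf; apply: (measurableT_comp (f := fun x : R => x `^ p)).
  exact: measurable_powR.
rewrite /enorm; apply: (measurableT_comp (f := @Num.sqrt R)).
  by apply: continuous_measurable_fun; exact: sqrt_continuous.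
by apply: measurable_sum => i; apply: measurable_funX; exact: mf.
Qed.

Local Open Scope ereal_scope.

(** The integrated defect is a difference of integrals that could be
    infinite, so the midpoint energy is first moved to the side of dp, and
    cancelled once all four integrals are known to be finite. *)
Lemma integral_uniform_convexity (C e : R) (fp gp mp dp : T -> R) :
  measurable_fun D fp -> measurable_fun D gp ->
  measurable_fun D mp -> measurable_fun D dp ->
  (forall x, 0 <= fp x)%R -> (forall x, 0 <= gp x)%R ->
  (forall x, 0 <= mp x)%R -> (forall x, 0 <= dp x)%R ->
  (0 <= C)%R -> (0 < e)%R ->
  (forall x, mp x <= (fp x + gp x) / 2)%R ->
  (forall x, dp x <= e * (fp x + gp x) + C * ((fp x + gp x) / 2 - mp x))%R ->
  forall M del : R,
  \int[mu]_(x in D) (fp x)%:E <= M%:E -> \int[mu]_(x in D) (gp x)%:E <= M%:E ->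
  \int[mu]_(x in D) (fp x)%:E + \int[mu]_(x in D) (gp x)%:E <=
    2%:E * (\int[mu]_(x in D) (mp x)%:E + del%:E) ->
  \int[mu]_(x in D) (dp x)%:E <= (2 * e * M + C * del)%:E.
Proof.
move=> mfp mgp mmp mdp fp0 gp0 mp0 dp0 C0 e0 mid key M del fM gM.
pose c := (e + C / 2)%R.
have c0 : (0 <= c)%R by rewrite addr_ge0 ?(ltW e0) ?divr_ge0.
have {}key x : (dp x + C * mp x <= c * (fp x + gp x))%R.
  have := key x; rewrite /c.
  move: (fp x) (gp x) (dp x) (mp x) => F G A B h.
  have -> : ((e + C / 2) * (F + G) =
    e * (F + G) + C * ((F + G) / 2 - B) + C * B)%R by field.
  by rewrite lerD2r.
have Ikey : \int[mu]_(x in D) (dp x)%:E + C%:E * \int[mu]_(x in D) (mp x)%:E <=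
    c%:E * \int[mu]_(x in D) (fp x)%:E + c%:E * \int[mu]_(x in D) (gp x)%:E.
  rewrite -[X in X + _ <= _]mul1e
      -(ge0_integral_lincomb mdp mmp dp0 mp0 ler01 C0).
  rewrite -(ge0_integral_lincomb mfp mgp fp0 gp0 c0 c0).
  apply: ge0_le_integral_EFin;
      do ?[apply: measurable_funD|exact: measurable_funM].
  by move=> x _; rewrite mul1r addr_ge0 ?mulr_ge0//= -mulrDr.
have Imid : 2%:E * \int[mu]_(x in D) (mp x)%:E +
    0%:E * \int[mu]_(x in D) (mp x)%:E <=
    1%:E * \int[mu]_(x in D) (fp x)%:E + 1%:E * \int[mu]_(x in D) (gp x)%:E.
  rewrite -(ge0_integral_lincomb mmp mmp mp0 mp0 (ler0n R 2) (lexx 0%R)).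
  rewrite -(ge0_integral_lincomb mfp mgp fp0 gp0 ler01 ler01).
  apply: ge0_le_integral_EFin;
      do ?[apply: measurable_funD|exact: measurable_funM].
  by move=> x _; rewrite mul0r addr0 !mul1r mulr_ge0//= -ler_pdivlMl// mulrC.
rewrite mul0e adde0 !mul1e in Imid.
have ge0 (h : T -> R) : (forall x, 0 <= h x)%R -> 0 <=
    \int[mu]_(x in D) (h x)%:E.
  by move=> h0; apply: integral_ge0 => x _; rewrite lee_fin.
move: (ge0 _ fp0) (ge0 _ gp0) (ge0 _ mp0) (ge0 _ dp0) fM gM Ikey Imid.
case: (\int[mu]_(x in D) (fp x)%:E) => [F| |]// F0.
case: (\int[mu]_(x in D) (gp x)%:E) => [G| |]// G0.
case: (\int[mu]_(x in D) (mp x)%:E) => [m| |]//; last first.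
  by move=> _ _ _ _ _; rewrite gt0_muley ?lte_fin// leye_eq.
move=> m0; case: (\int[mu]_(x in D) (dp x)%:E) => [I| |]//.
rewrite !lee_fin => I0 FM GM.
rewrite /c => Ikey _ h; clear -Ikey h FM GM C0 e0.
have h1 : (0 <= e * (M - F))%R by rewrite mulr_ge0 ?subr_ge0// ltW.
have h2 : (0 <= e * (M - G))%R by rewrite mulr_ge0 ?subr_ge0// ltW.
have h3 : (0 <= C * (2 * (m + del) - (F + G)))%R by rewrite mulr_ge0 ?subr_ge0.
lra.
Qed.

(** Two maps of bounded p-energy whose midpoint loses almost no energy are
    close. The bound of enorm_powR_uniformly_convex is integrated with a
    weight eps / (4 * M) on the energies, so that these contribute at most
    eps / 2, and del makes the defect contribute less than eps / 2. *)
Lemma Lp_uniformly_convex p (M eps : R) : (1 < p)%R -> (0 < M)%R ->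
    (0 < eps)%R ->
  exists2 del : R, (0 < del)%R & forall f g,
    (forall i, measurable_fun D (fun x => f x ord0 i)) ->
    (forall i, measurable_fun D (fun x => g x ord0 i)) ->
    \int[mu]_(x in D) (enorm (f x) `^ p)%:E <= M%:E ->
    \int[mu]_(x in D) (enorm (g x) `^ p)%:E <= M%:E ->
    \int[mu]_(x in D) (enorm (f x) `^ p)%:E +
      \int[mu]_(x in D) (enorm (g x) `^ p)%:E <=
      2%:E *
        (\int[mu]_(x in D) (enorm (2^-1 *: (f x + g x))%R `^ p)%:E + del%:E) ->
    \int[mu]_(x in D) (enorm (f x - g x)%R `^ p)%:E <= eps%:E.
Proof.
move=> p1 M0 e0.
have e40 : (0 < eps / (4 * M))%R by rewrite divr_gt0// mulr_gt0.
have [C C0 CP] := @enorm_powR_uniformly_convex R n p _ p1 e40.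
set e' := (eps / (4 * M))%R in e40 CP.
(* The summand 1 keeps the denominator positive when C = 0. *)
exists (eps / (2 * (C + 1)))%R => [|f g mf mg fM gM].
  by rewrite divr_gt0// mulr_gt0// ltr_wpDl.
set fp := fun x => (enorm (f x) `^ p)%R;
    set gp := fun x => (enorm (g x) `^ p)%R.
set mp := fun x => (enorm (2^-1 *: (f x + g x)) `^ p)%R.
set dp := fun x => (enorm (f x - g x) `^ p)%R.
rewrite -/(fp _) -/(gp _) -/(mp _).
have mfp : measurable_fun D fp by exact: measurable_enorm_powR.
have mgp : measurable_fun D gp by exact: measurable_enorm_powR.
have mmp : measurable_fun D mp.
  apply: measurable_enorm_powR => i.
  rewrite (_ : (fun _ => _) = fun x => (2^-1 * (f x ord0 i + g x ord0 i))%R).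
    by apply: measurable_funM => //; exact: measurable_funD.
  by apply/funext => x; rewrite !mxE.
have mdp : measurable_fun D dp.
  apply: measurable_enorm_powR => i.
  rewrite (_ : (fun _ => _) = fun x => (f x ord0 i - g x ord0 i)%R).
    exact: measurable_funB.
  by apply/funext => x; rewrite !mxE.
have fp0 x : (0 <= fp x)%R by exact: powR_ge0.
have gp0 x : (0 <= gp x)%R by exact: powR_ge0.
have mp0 x : (0 <= mp x)%R by exact: powR_ge0.
have dp0 x : (0 <= dp x)%R by exact: powR_ge0.
move=> h.
apply: (le_trans (@integral_uniform_convexity C e' fp gp mp dp _ _ _ _ _ _ _ _ _
    _ _ _ M _ fM gM h)) => //.
- by move=> x; exact: enorm_powR_mid_le.
- by move=> x; exact: CP.
rewrite lee_fin.
have e'E : (e' * (4 * M) = eps)%R by rewrite /e' divfK// gt_eqF// mulr_gt0.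
have C1 : (0 < C + 1)%R by lra.
have delE : (eps / (2 * (C + 1)) * (C + 1) = eps / 2)%R by field;
    rewrite gt_eqF.
have del0 : (0 <= eps / (2 * (C + 1)))%R by rewrite divr_ge0// ?ltW// mulr_gt0.
move: delE del0; move: (eps / (2 * (C + 1)))%R => del delE del0.
clear -e'E delE del0; nra.
Qed.

End Lp_uniform_convexity.

(** * Rapidly Cauchy sequences of p-integrable functions *)

Section Lp_complete.
Context d (T : measurableType d) (R : realType)
    (mu : {measure set T -> \bar R}).
Context (D : set T) (mD : measurable D).
Implicit Types (p : R).

Lemma limn_einf_le (u : (\bar R)^nat) (c : \bar R) (n : nat) :
  (forall k, (n <= k)%N -> (u k <= c)%E) -> (limn_einf u <= c)%E.
Proof.
move=> uc; rewrite limn_einf_lim; apply: lime_le; first exact: is_cvg_einfs.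
near=> m; apply: le_trans (uc (maxn m n) (leq_maxr _ _)).
by apply: ereal_inf_lbound; exists (maxn m n) => //=; exact: leq_maxl.
Unshelve. all: by end_near. Qed.

(** Fatou's lemma in the form in which lower semicontinuity is used: a
    bound valid from some rank on passes to an almost everywhere limit. *)
Lemma fatou_le (f : nat -> T -> R) (g : T -> R) (c : \bar R) (n : nat) :
  (forall k, measurable_fun D (f k)) -> measurable_fun D g ->
  (forall k x, 0 <= f k x) -> (forall x, 0 <= g x) ->
  {ae mu, forall x, D x -> f ^~ x @ \oo --> g x} ->
  (forall k, (n <= k)%N -> \int[mu]_(x in D) (f k x)%:E <= c)%E ->
  (\int[mu]_(x in D) (g x)%:E <= c)%E.
Proof.
move=> mf mg f0 g0 fg fc.
apply: le_trans (limn_einf_le fc).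
apply: le_trans (fatou mu mD (f := fun k x => (f k x)%:E) _ _); last 2 first.
- by move=> k; exact/measurable_EFinP.
- by move=> k x _; rewrite lee_fin.
rewrite le_eqVlt; apply/orP; left; apply/eqP.
apply: ge0_ae_eq_integral => //.
- exact/measurable_EFinP.
- rewrite /limn_einf; apply: measurableT_comp => //.
  apply: measurable_fun_limn_esup => k; apply: measurableT_comp => //.
  exact/measurable_EFinP.
- by move=> x _; rewrite lee_fin.
- move=> x _; rewrite limn_einf_lim; apply: lime_ge; first exact: is_cvg_einfs.
  by near=> k; apply: le_ereal_inf_tmp => _ [m _ <-]; rewrite lee_fin.
apply: filterS fg => x fgx Dx.
have : (EFin \o f ^~ x) @ \oo --> (g x)%:E by apply: cvg_EFin;
    [exact: nearW|exact: fgx].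
by move=> /cvg_limn_einf_sup[<- _].
Unshelve. all: by end_near. Qed.

(** The p-energy allowed at rank n, the product of two factors with r = 2 ^
    (- (n + 1)): the factor r `^ p is the energy of an increment of size r,
    and the factor r makes the energies of the increments divided by their
    sizes summable. *)
Definition rate p (n : nat) : R := let r := (2 ^ n.+1)%:R^-1 in r * r `^ p.

Lemma cvg_telescope_geometric (a : nat -> R) (c : R) :
  (forall k, `|a k - a k.+1| <= c * (2 ^ k.+1)%:R^-1) -> cvgn a.
Proof.
move=> ac; have c0 : 0 <= c.
  by have := le_trans (normr_ge0 _) (ac 0%N);
      rewrite pmulr_lge0// invr_gt0 ltr0n.
suff : cvgn (series (telescope a)).
  move=> ca; rewrite (_ : a = cst (a 0%N) \+ series (telescope a)).
    by apply: is_cvgD => //; exact: is_cvg_cst.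
  by apply/funext => n; rewrite /= -eq_sum_telescope.
apply: normed_cvg; apply: (series_le_cvg (v_ := geometric (c / 2) 2^-1)).
- by move=> n; exact: normr_ge0.
- by move=> n; rewrite /geometric/= mulr_ge0 ?divr_ge0.
- move=> n; rewrite /telescope /geometric/= distrC (le_trans (ac n))//.
  by rewrite expnS natrM invfM mulrA natrX exprVn.
- by apply: is_cvg_geometric_series; rewrite ger0_norm// invf_lt1// ltr1n.
Qed.

(** Riesz-Fischer along a rapid sequence. The sum S of the energies of the
    scaled increments is integrable, hence finite almost everywhere; where
    it is finite, the n-th increment is at most a constant times 2 ^ (- (n
    + 1)), so the sequence converges. Fatou's lemma gives the distance to
    the limit. *)
Lemma Lp_rapid_cauchy_cvg p (f : nat -> T -> R) : 0 < p ->
  (forall k, measurable_fun D (f k)) ->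
  (forall n k, (n <= k)%N ->
    \int[mu]_(x in D) (`|f n x - f k x| `^ p)%:E <= (rate p n)%:E)%E ->
  exists g : T -> R, [/\ measurable_fun D g,
    {ae mu, forall x, D x -> f ^~ x @ \oo --> g x} &
    forall n, (\int[mu]_(x in D) (`|f n x - g x| `^ p)%:E <= (rate p n)%:E)%E].
Proof.
move=> p0 mf fc.
pose r k : R := (2 ^ k.+1)%:R^-1.
have r0 k : 0 < r k by rewrite invr_gt0 ltr0n expn_gt0.
pose w k x := (r k `^ p)^-1 * `|f k x - f k.+1 x| `^ p.
have mdiff k l : measurable_fun D (fun x => `|f k x - f l x|).
  apply: measurableT_comp => //; exact: measurable_funB.
have mw k : measurable_fun D (w k).
  apply: measurable_funM => //.
  by apply: (measurableT_comp (f := fun x : R => x `^ p)) => //;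
      exact: measurable_powR.
have w0 k x : 0 <= w k x by rewrite mulr_ge0 ?invr_ge0 ?powR_ge0.
pose S x := (\sum_(k <oo) (w k x)%:E)%E.
have S0 x : (0 <= S x)%E by apply: nneseries_ge0 => k _ _; rewrite lee_fin.
have mS : measurable_fun D S.
  apply: ge0_emeasurable_sum => [k x Dx _|k _]; first by rewrite lee_fin.
  exact/measurable_EFinP.
have intS : mu.-integrable D S.
  apply/integrableP; split => //.
  under eq_integral do rewrite gee0_abs//.
  rewrite integral_nneseries//; last 2 first.
  - by move=> k; exact/measurable_EFinP.
  - by move=> k x _; rewrite lee_fin.
  apply: (@le_lt_trans _ _ 1%:E); last exact: ltry.
  apply: le_trans (epsilon_trick0 xpredT (@ler01 R)).
  apply: lee_nneseries => [k _ _|k _]; first by apply: integral_ge0 => x _;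
      rewrite lee_fin.
  rewrite div1r -/(r k); under eq_integral do rewrite EFinM.
  rewrite ge0_integralZl_EFin ?invr_ge0 ?powR_ge0//; last first.
    apply/measurable_EFinP.
    by apply: (measurableT_comp (f := fun x : R => x `^ p)).
  apply: (@le_trans _ _ (((r k `^ p)^-1)%:E * (rate p k)%:E)%E).
    by apply: lee_wpmul2l; rewrite ?lee_fin ?invr_ge0 ?powR_ge0//; exact: fc.
  rewrite -EFinM lee_fin /rate -/(r k) mulrCA mulVf ?mulr1//.
  by rewrite gt_eqF// powR_gt0.
pose A := D `&` [set x | S x \is a fin_num].
have mA : measurable A by exact: (emeasurable_fin_num mD mS).
have cvgA x : A x -> cvgn (f ^~ x).
  move=> [Dx Sx].
  apply: (@cvg_telescope_geometric _ (fine (S x) `^ p^-1)) => k;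
      rewrite -/(r k).
  have wS : w k x <= fine (S x).
    rewrite -lee_fin fineK// /S (@nneseriesD1 _ _ k)//; last first.
      by move=> i _; rewrite lee_fin.
    by rewrite leeDl// nneseries_ge0// => i _ _; rewrite lee_fin.
  have fS0 : 0 <= fine (S x) by exact: fine_ge0.
  have root y : 0 <= y -> (y `^ p) `^ p^-1 = y.
    by move=> y0; rewrite -powRrM mulfV ?gt_eqF// powRr1.
  rewrite -[leLHS]root// -(root (r k) (ltW (r0 k))) -powRM ?powR_ge0//.
  apply: ge0_ler_powR; rewrite ?nnegrE ?invr_ge0 ?mulr_ge0 ?powR_ge0
      ?(ltW p0)//.
  by rewrite -ler_pdivrMr ?powR_gt0// mulrC.
(* Cutting off outside A makes the sequence converge at every point, so
   that the limit is measurable. *)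
pose h k x := f k x * \1_A x.
pose g x := limn (h ^~ x).
have cvgh x : D x -> h ^~ x @ \oo --> g x.
  move=> Dx; rewrite /g; have [Ax|Ax] := pselect (A x).
    by rewrite /h indicE mem_set//; under eq_fun do rewrite mulr1; exact: cvgA.
  rewrite /h indicE memNset//; under eq_fun do rewrite mulr0.
  exact: is_cvg_cst.
have hA x : A x -> h ^~ x = f ^~ x.
  by move=> Ax; apply/funext => k; rewrite /h indicE mem_set// mulr1.
have mg : measurable_fun D g.
  apply: (measurable_fun_cvg (h := h)) => // k.
  by apply: measurable_funM => //; exact: measurable_indic.
have aeg : {ae mu, forall x, D x -> f ^~ x @ \oo --> g x}.
  apply: filterS (integrable_ae mD intS) => x Sx Dx.
  by rewrite -hA; [exact: cvgh|split => //; exact: Sx].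
exists g; split => // n.
apply: (@fatou_le (fun k x => `|f n x - f k x| `^ p) _ _ n).
- by move=> k; apply: (measurableT_comp (f := fun x : R => x `^ p)) => //;
    exact: measurable_powR.
- apply: (measurableT_comp (f := fun x : R => x `^ p));
    first exact: measurable_powR.
  by apply: measurableT_comp => //; exact: measurable_funB.
- by move=> k x; exact: powR_ge0.
- by move=> x; exact: powR_ge0.
- apply: filterS aeg => x fg Dx.
  have -> : (fun k => `|f n x - f k x| `^ p) =
      (fun y => `|y| `^ p) \o (fun k => f n x - f k x) by [].
  apply: continuous_cvg; first exact: continuous_norm_powR.
  by apply: cvgB; [exact: cvg_cst|exact: fg].
- by move=> k nk; exact: fc.
Qed.

End Lp_complete.

(** * Boxes in the product of two copies of R^N *)

Section boxes.
Context {R : realType} {N : nat}.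
Local Notation V := ('rV[R]_N * 'rV[R]_N)%type.
Local Notation J := ('I_N + 'I_N)%type.

(** Indexing by a sum type treats the two blocks of N coordinates
    uniformly. *)
Definition pcoord (k : J) (z : V) : R :=
  match k with inl i => z.1 ord0 i | inr i => z.2 ord0 i end.

Lemma measurable_pcoord k : measurable_fun [set: V] (pcoord k).
Proof.
case: k => i.
  exact: (measurableT_comp (measurable_coord i) measurable_fst).
exact: (measurableT_comp (measurable_coord i) measurable_snd).
Qed.

Lemma continuous_pcoord k : continuous (pcoord k).
Proof.
case: k => i z.
  apply: (@continuous_comp _ _ _ fst (fun v : 'rV[R]_N => v ord0 i)).
    exact: cvg_fst.
  exact: coord_continuous.
apply: (@continuous_comp _ _ _ snd (fun v : 'rV[R]_N => v ord0 i)).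
  exact: cvg_snd.
exact: coord_continuous.
Qed.

Definition box (a b : J -> R) : set V :=
  [set z | forall k, a k < pcoord k z < b k].
Definition cbox (a b : J -> R) : set V :=
  [set z | forall k, a k <= pcoord k z <= b k].

Lemma box_cbox a b : box a b `<=` cbox a b.
Proof. by move=> z zb k; have /andP[/ltW -> /ltW ->] := zb k. Qed.

Lemma measurable_box a b : measurable (box a b).
Proof.
rewrite (_ : box a b = \bigcap_(k in [set: J])
    (pcoord k @^-1` `]a k, b k[%classic)).
  apply: fin_bigcap_measurable => // k _; rewrite -[X in measurable X]setTI.
  by apply: measurable_pcoord.
by apply/seteqP; split => [z zb k _|z zb k]; [|have := zb k I];
    rewrite /= in_itv/=.
Qed.

Lemma measurable_cbox a b : measurable (cbox a b).
Proof.
rewrite (_ : cbox a b = \bigcap_(k in [set: J])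
    (pcoord k @^-1` `[a k, b k]%classic)).
  apply: fin_bigcap_measurable => // k _; rewrite -[X in measurable X]setTI.
  by apply: measurable_pcoord.
by apply/seteqP; split => [z zb k _|z zb k]; [|have := zb k I];
    rewrite /= in_itv/=.
Qed.

Lemma compact_cbox a b : compact (cbox a b).
Proof.
pose A (f : 'I_N -> J) := [set v : 'rV[R]_N | forall i,
    `[a (f i), b (f i)]%classic (v ord0 i)].
have cA f : compact (A f).
  apply: (@rV_compact R N (fun i => `[a (f i), b (f i)]%classic)) => i.
  exact: segment_compact.
rewrite (_ : cbox a b = A inl `*` A inr); first exact: compact_setX.
apply/seteqP; split => [z zb|z [z1 z2] [i|i]].
- by split => i /=; [have := zb (inl i)|have := zb (inr i)]; rewrite /= in_itv.
- by have := z1 i; rewrite /= in_itv.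
- by have := z2 i; rewrite /= in_itv.
Qed.

(** Rational endpoints, so that countably many boxes suffice to cover an
    open set. *)
Lemma box_in_open (A : set V) z : open A -> A z ->
  exists ab : {ffun J -> rat} * {ffun J -> rat},
    box (fun k => ratr (ab.1 k)) (fun k => ratr (ab.2 k)) z /\
    cbox (fun k => ratr (ab.1 k)) (fun k => ratr (ab.2 k)) `<=` A.
Proof.
move=> oA Az; have /nbhs_ballP[e /= e0 eA] : nbhs z A by exact: open_nbhs_nbhs.
have /choice[a aP] : forall k : J, exists q : rat, pcoord k z - e < ratr q <
    pcoord k z.
  move=> k; have [|q] := @rat_in_itvoo R (pcoord k z - e) (pcoord k z).
    by rewrite gtrBl.
  by rewrite in_itv/=; exists q.
have /choice[b bP] : forall k : J, exists q : rat, pcoord k z < ratr q <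
    pcoord k z + e.
  move=> k; have [|q] := @rat_in_itvoo R (pcoord k z) (pcoord k z + e).
    by rewrite ltrDl.
  by rewrite in_itv/=; exists q.
exists ([ffun k => a k], [ffun k => b k]); split => /=.
  by move=> k; rewrite !ffunE; have /andP[_ ->] := aP k;
      have /andP[-> _] := bP k.
move=> y yb; apply: eA.
have key k : `|pcoord k z - pcoord k y| < e.
  have := yb k; rewrite !ffunE => /andP[ay yb']; rewrite ltr_distl.
  have /andP[a1 a2] := aP k; have /andP[b1 b2] := bP k.
  by apply/andP; split; lra.
by split; split => // i j; rewrite (ord1 i);
    [exact: (key (inl j))|exact: (key (inr j))].
Qed.

Lemma open_measurable_prV (A : set V) : open A -> measurable A.
Proof.
move=> oA.
pose B (ab : {ffun J -> rat} * {ffun J -> rat}) : set V :=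
  box (fun k => ratr (ab.1 k)) (fun k => ratr (ab.2 k)).
have -> : A = \bigcup_(ab in [set ab | B ab `<=` A]) B ab.
  apply/seteqP; split => [z Az|z [ab BA]]; last exact: BA.
  have [ab [zB BA]] := box_in_open oA Az.
  by exists ab => //; apply: subset_trans BA; exact: box_cbox.
rewrite bigcup_mkcond; apply: countable_bigcupT_measurable => // ab.
by case: ifP => // _; exact: measurable_box.
Qed.

Lemma compact_measurable_prV (K : set V) : compact K -> measurable K.
Proof.
move=> cK; rewrite -(setCK K); apply: measurableC; apply: open_measurable_prV.
by rewrite openC; apply: compact_closed.
Qed.

Lemma continuous_measurable_prV (f : V -> R) : continuous f ->
  measurable_fun [set: V] f.
Proof.
move=> cf; apply: (measurability _ (RGenOpens.measurableE R)).
move=> _ [_ [a [b ->] <-]]; rewrite setTI; apply: open_measurable_prV.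
move/continuousP: cf; apply; exact: interval_open.
Qed.

(** Only half-spaces have to be generated by boxes, because the product
    sigma-algebra is generated by the coordinates; the half-space x <
    pcoord k z is the union over m of the boxes with k-th side (x, m) and
    all other sides (- m, m). *)
Lemma measurable_prV_boxes :
  @measurable _ V = <<s [set box ab.1 ab.2 | ab in [set: (J -> R) * (J -> R)]]
      >>.
Proof.
apply/seteqP; split; last first.
  apply: smallest_sub; first exact: sigma_algebra_measurable.
  by move=> _ [ab _ <-]; exact: measurable_box.
set G := [set _ | _ in _].
pose U := g_sigma_algebraType G.
(* U is the same space with the sigma-algebra generated by the boxes; the
   claim is that the identity map of U is measurable for the product sigma-
   algebra. *)
suff mid : measurable_fun [set: U] (fun z : U => (z : V)).
  by move=> A mA; have := mid measurableT A mA; rewrite setTI.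
have mco k : measurable_fun [set: U] (pcoord k : U -> R).
  apply: (measurability _ (RGenOInfty.measurableE R)).
  move=> _ [_ [x ->] <-]; rewrite setTI.
  rewrite (_ : _ @^-1` _ = \bigcup_m box
      (fun k' => if k' == k then x else - m%:R) (fun=> m%:R)).
    apply: bigcupT_measurable => m; apply: sub_sigma_algebra.
    by exists (fun k' => if k' == k then x else - m%:R, fun=> m%:R).
  apply/seteqP; split => [z|z [m _ zb]]; last first.
    by have := zb k; rewrite eqxx /= in_itv/= andbT => /andP[].
  rewrite /= in_itv/= andbT => xz.
  (* M bounds all coordinates of z, so any m > M gives a box around z. *)
  pose M := \sum_k `|pcoord k z|.
  exists (Num.truncn M).+1 => // k'.
  have zM : `|pcoord k' z| < (Num.truncn M).+1%:R.
    apply: le_lt_trans (truncnS_gt M).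
    by rewrite /M (bigD1 k')//= lerDl sumr_ge0.
  by move: zM; rewrite ltr_norml => /andP[? ->]; case: eqP => [->|_];
      rewrite andbT.
apply/measurable_fun_pairP; split; apply: measurable_fun_rVP => i.
  exact: (mco (inl i)).
exact: (mco (inr i)).
Qed.

Lemma setI_box a b c d : box a b `&` box c d =
  box (fun k => Num.max (a k) (c k)) (fun k => Num.min (b k) (d k)).
Proof.
apply/seteqP; split => [z [z1 z2] k|z zb].
  have := z1 k; have := z2 k; rewrite gt_max lt_min.
  by move=> /andP[-> ->] /andP[-> ->].
by split => k; have := zb k; rewrite gt_max lt_min =>
    /andP[/andP[? ?] /andP[? ?]]; apply/andP.
Qed.

Lemma setI_closed_boxes :
  setI_closed [set box ab.1 ab.2 | ab in [set: (J -> R) * (J -> R)]].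
Proof.
move=> _ _ [ab _ <-] [cd _ <-]; rewrite setI_box.
by exists (fun k => Num.max (ab.1 k) (cd.1 k), fun k =>
    Num.min (ab.2 k) (cd.2 k)).
Qed.

End boxes.

(** * Compact sets and test integrals *)

Section compact_measure.
Context {R : realType} {N : nat}.
Local Notation V := ('rV[R]_N * 'rV[R]_N)%type.
Local Notation lambda := (lebesgue_rV N : {measure set 'rV[R]_N -> \bar R}).
Local Notation lambda2 := (lebesgue_rV N \x lebesgue_rV N)%E.

Lemma compact_measurable_rV (K : set 'rV[R]_N) : compact K -> measurable K.
Proof.
move=> cK; rewrite -(setCK K); apply: measurableC; apply: open_measurable_rV.
by rewrite openC; apply: compact_closed.
Qed.

(** A compact set lies in a cube, whose measure is given by
    lebesgue_rV_box. *)
Lemma lebesgue_rV_compact (K : set 'rV[R]_N) : compact K -> (lambda K < +oo)%E.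
Proof.
move=> cK; have [M [Mreal KM]] := compact_bounded cK.
pose A (i : 'I_N) : set R := `[- (M + 1), M + 1]%classic.
have mA i : measurable (A i) by exact: measurable_itv.
have KA : K `<=` [set v | forall i, A i (v ord0 i)].
  move=> v /KM vM i; rewrite /A /= in_itv/= -ler_norml.
  apply: le_trans (vM (M + 1) _); last by rewrite ltrDl.
  have /mapP[j Hj ->] : `|v ord0 i| \in [seq `|v x.1 x.2| | x : 'I_1 * 'I_N].
    by apply/mapP; exists (ord0, i) => //=; rewrite mem_enum.
  by rewrite [leRHS]/Num.norm /= mx_normrE; apply/bigmax_geP; right => /=;
      exists j.
apply: (@le_lt_trans _ _ (lambda [set v | forall i, A i (v ord0 i)])).
  apply: le_measure; rewrite ?inE//; first exact: compact_measurable_rV.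
  rewrite [X in measurable X](_ : _ =
      \bigcap_(i in [set: 'I_N]) (fun v : 'rV[R]_N => v ord0 i) @^-1` A i).
    apply: fin_bigcap_measurable => // i _; rewrite -[X in measurable X]setTI.
    exact: measurable_coord.
  by apply/seteqP; split => v h i; [move=> _; exact: h|exact: h].
have -> := lebesgue_rV_box mA : lambda _ = _; rewrite -ge0_fin_numE;
    last by apply: prode_ge0 => i _.
apply: prode_fin_num => i _.
by rewrite /A lebesgue_measure_itv/=; case: ifP.
Qed.

Lemma lebesgue2_setX (K : set 'rV[R]_N) : compact K ->
    (lambda2 (K `*` K) < +oo)%E.
Proof.
move=> cK; have mK := compact_measurable_rV cK; rewrite product_measure1E//.
by rewrite lte_mul_pinfty// ?ge0_fin_numE// lebesgue_rV_compact.
Qed.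

Lemma lebesgue2_compact (K : set V) : compact K -> (lambda2 K < +oo)%E.
Proof.
move=> cK; pose K' := fst @` K `|` snd @` K.
have cK' : compact K'.
  apply: compactU; apply: continuous_compact => //;
      apply: continuous_subspaceT => z.
    exact: cvg_fst.
  exact: cvg_snd.
apply: (@le_lt_trans _ _ (lambda2 (K' `*` K'))); last exact: lebesgue2_setX.
apply: le_measure; rewrite ?inE//.
- exact: compact_measurable_prV.
- by apply: measurableX; exact: compact_measurable_rV.
- by move=> z Kz; split; [left|right]; exists z.
Qed.
End compact_measure.

Section integrable_test.
Context d (T : measurableType d) (R : realType)
    (mu : {measure set T -> \bar R}).
Context (D K : set T) (mD : measurable D) (mK : measurable K) (KD : K `<=` D).
Implicit Types f phi : T -> R.

(** A locally integrable function need only be integrable on the support K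
    of the bounded factor. *)
Lemma integrable_mul_test f phi (C : R) :
  measurable_fun D f -> measurable_fun D phi -> mu.-integrable K (EFin \o f) ->
  (forall x, D x -> `|phi x| <= C) -> (forall x, D x -> ~ K x -> phi x = 0) ->
  mu.-integrable D (fun x => (f x * phi x)%:E).
Proof.
move=> mf mphi fi phiC phi0.
rewrite (_ : (fun x => _) = EFin \o (f \* phi))//.
apply: (@eq_integrable _ _ _ mu D mD ((EFin \o (f \* phi)) \_ K)).
  move=> x /set_mem Dx; rewrite patchE; case: ifPn => //=.
  by rewrite notin_setE => nKx; rewrite phi0// mulr0.
apply/integrable_restrict => //; rewrite setIidr//.
rewrite (_ : EFin \o _ = ((EFin \o f) \* (EFin \o phi))%E)//.
apply: integrableMl => //; first exact: measurable_funS mphi.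
exists C; split; [exact: num_real|] => M CM x Kx; apply: le_trans (ltW CM);
    exact/phiC/KD.
Qed.

Lemma Rintegral_support (F : T -> R) : (forall x, D x -> ~ K x -> F x = 0) ->
  \int[mu]_(x in D) F x = \int[mu]_(x in K) F x.
Proof.
move=> F0; rewrite /Rintegral -[in RHS](setIidr KD) integral_mkcondr;
    congr fine.
apply: eq_integral => x /set_mem Dx; rewrite patchE; case: ifPn => //.
by rewrite notin_setE => nKx; rewrite F0.
Qed.

End integrable_test.

(** * Calculus of functions of class C^1 *)

Section C1_calculus.
Context {R : realType}.

(** Continuity at a point is local; this replaces a differential by its
    explicit formula, which is valid only on the open set. *)
Lemma near_eq_continuous (T U : topologicalType) (f g : T -> U) z :
  (\forall z' \near z, f z' = g z') -> {for z, continuous g} ->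
      {for z, continuous f}.
Proof.
move=> fg cg; rewrite /prop_for /continuous_at (nbhs_singleton fg).
by apply: cvg_trans cg; apply: near_eq_cvg; apply: filterS fg => z' ->.
Qed.

Context {V : normedModType R} (A : set V) (oA : open A).
Implicit Types (f g : V -> R).

Let nearA z : A z -> \forall z' \near z, A z'.
Proof. by move=> Az; exact: open_nbhs_nbhs. Qed.

Lemma C1_on_continuous f : C1_on A f -> forall z, A z -> {for z, continuous f}.
Proof. by move=> Cf z /Cf[df _]; exact: differentiable_continuous. Qed.

Lemma C1_on_cst (c : R) : C1_on A (cst c).
Proof.
move=> z Az; split; first exact: differentiable_cst.
move=> v; rewrite (_ : (fun z' => _) = cst 0); first exact: cst_continuous.
by apply/funext => z'; rewrite diff_cst.
Qed.

Lemma C1_on_linear (f : {linear V -> R}) : continuous f -> C1_on A f.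
Proof.
move=> cf z Az; split; first exact: linear_differentiable.
move=> v; rewrite (_ : (fun z' => _) = cst (f v)); first exact: cst_continuous.
by apply/funext => z'; rewrite diff_lin.
Qed.

Lemma C1_onM f g : C1_on A f -> C1_on A g -> C1_on A (f * g).
Proof.
move=> Cf Cg z Az; have [df cf] := Cf z Az; have [dg cg] := Cg z Az.
split; first exact: differentiableM.
move=> v; apply: (@near_eq_continuous _ _ _
    (fun z' => f z' * 'd g z' v + g z' * 'd f z' v)).
  apply: filterS (nearA Az) => z' Az'; have [df' _] := Cf z' Az';
      have [dg' _] := Cg z' Az'.
  by rewrite diffM.
have cf0 := C1_on_continuous Cf Az; have cg0 := C1_on_continuous Cg Az.
apply: (@continuousD _ _ _ (fun z' => f z' * 'd g z' v)
    (fun z' => g z' * 'd f z' v)).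
  exact: (continuousM cf0 (cg v)).
exact: (continuousM cg0 (cf v)).
Qed.

Lemma C1_onB f g : C1_on A f -> C1_on A g -> C1_on A (f - g).
Proof.
move=> Cf Cg z Az; have [df cf] := Cf z Az; have [dg cg] := Cg z Az.
split; first exact: differentiableB.
move=> v; apply: (@near_eq_continuous _ _ _ (fun z' => 'd f z' v - 'd g z' v)).
  apply: filterS (nearA Az) => z' Az'; have [df' _] := Cf z' Az';
      have [dg' _] := Cg z' Az'.
  by rewrite diffB.
exact: (continuousB (cf v) (cg v)).
Qed.

Lemma C1_on_comp_real f (theta dtheta : R -> R) : continuous dtheta ->
  (forall t : R, is_derive t 1 theta (dtheta t)) -> C1_on A f ->
      C1_on A (theta \o f).
Proof.
move=> cdt dt Cf z Az; have [df cf] := Cf z Az.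
have dtheta_diff t : differentiable theta t.
  by apply/derivable1_diffP; have [] := dt t.
split; first exact: differentiable_comp.
move=> v; apply: (@near_eq_continuous _ _ _
    (fun z' => 'd f z' v * dtheta (f z'))).
  apply: filterS (nearA Az) => z' Az'; have [df' _] := Cf z' Az'.
  rewrite diff_comp//= diff1E//; congr (_ * _).
  by rewrite derive1E; have [] := dt (f z').
have cf0 := C1_on_continuous Cf Az.
exact: (continuousM (cf v) (continuous_comp cf0 (cdt _))).
Qed.

Lemma C1_on_prod (I : Type) (r : seq I) (F : I -> V -> R) :
  (forall i, C1_on A (F i)) -> C1_on A (fun z => \prod_(i <- r) F i z).
Proof.
move=> CF; elim: r => [|i r IH].
  by under eq_fun do rewrite big_nil; exact: C1_on_cst.
have -> : (fun z => \prod_(j <- i :: r) F j z) =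
    F i * (fun z => \prod_(j <- r) F j z).
  by apply/funext => z; rewrite big_cons.
by apply: C1_onM; [exact: CF|exact: IH].
Qed.

End C1_calculus.

Lemma C1_on_comp_linear (R : realType) (V : normedModType R) (A : set V)
    (f : V -> R) (L : {linear V -> V}) :
  continuous L -> (forall z, A z -> A (L z)) -> C1_on A f -> open A ->
  C1_on A (f \o L).
Proof.
move=> cL AL Cf oA z Az; have [df cf] := Cf _ (AL _ Az).
have dL z' : differentiable L z' by exact: linear_differentiable.
split; first exact: differentiable_comp.
move=> v; apply: (@near_eq_continuous _ _ _ (fun z' => 'd f (L z') (L v))).
  apply: filterS (open_nbhs_nbhs (conj oA Az)) => z' Az';
      have [df' _] := Cf _ (AL _ Az').
  by rewrite diff_comp//= diff_lin.
by apply: (@continuous_comp _ _ _ L (fun w => 'd f w (L v)));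
    [exact: cL|exact: cf].
Qed.

Section bump1D.
Context {R : realType}.

(** The simplest function of class C^1 on R that vanishes exactly on the
    half-line t <= 0. *)
Definition sqpos (t : R) : R := Num.max 0 t ^+ 2.

Lemma is_derive_sqpos (t : R) : is_derive t (1 : R) sqpos (2 * Num.max 0 t).
Proof.
have [t0|t0|->] := ltgtP t 0.
- rewrite mulr0.
  have dc : is_derive t (1 : R) (cst 0 : R -> R) 0 by exact: is_derive_cst.
  apply: near_eq_is_derive dc.
  near=> s; rewrite /sqpos max_l ?expr0n//=; apply/ltW; near: s;
      exact: lt_nbhsl.
- have dc : is_derive t (1 : R) ((@id R) * (@id R)) (2 * t).
    have h := is_deriveM (is_derive_id t (1 : R)) (is_derive_id t (1 : R)).
    by apply: (is_derive_eq h); rewrite [_%:A]mulr1 mulr_natl mulr2n.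
  apply: near_eq_is_derive dc.
  by near=> s; rewrite /sqpos max_r ?expr2//; apply/ltW; near: s;
      exact: lt_nbhsr.
- rewrite mulr0.
  suff h : h^-1 *: ((sqpos \o shift 0) (h *: 1) - sqpos 0) @[h --> 0^'] -->
      (0 : R).
    by apply: DeriveDef; [apply/cvg_ex; exists 0|exact/cvg_lim].
  apply/cvgr0Pnorm_lt => e e0; near=> h.
  rewrite /= addr0 /sqpos maxxx expr0n/= subr0 [_%:A]mulr1.
  have h0 : h != 0 by near: h; exact: nbhs_dnbhs_neq.
  rewrite normrZ normfV normrX mulrC ltr_pdivrMr ?normr_gt0//.
  apply: (@le_lt_trans _ _ (`|h| ^+ 2)).
    rewrite lerXn2r ?nnegrE//; case: (leP 0 h) => h1; rewrite ?normr0//.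
  rewrite expr2 ltr_pM2r ?normr_gt0//; near: h; apply: dnbhs0_lt => //.
Unshelve. all: by end_near. Qed.

Lemma continuous_maxr0 : continuous (fun t : R => 2 * Num.max 0 t).
Proof.
move=> t; apply: cvgM; first exact: cvg_cst.
apply: continuous_max; [exact: cst_continuous|exact: cvg_id].
Qed.

Lemma sqpos_ge0 t : 0 <= sqpos t. Proof. exact: sqr_ge0. Qed.

Lemma sqpos_eq0 t : (sqpos t == 0) = (t <= 0).
Proof. 
rewrite /sqpos sqrf_eq0; have [t0|t0] := leP t 0; first by rewrite eqxx.
by rewrite gt_eqF.
Qed.

End bump1D.

(** * Bump functions of boxes *)

Lemma open_setX (T U : topologicalType) (A : set T) (B : set U) :
  open A -> open B -> open (A `*` B).
Proof.
move=> oA oB; rewrite openE => -[x y] [/= Ax By].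
by exists (A, B) => //; split; exact: open_nbhs_nbhs.
Qed.

Section bump.
Context {R : realType} {N : nat}.
Local Notation V := ('rV[R]_N * 'rV[R]_N)%type.
Local Notation J := ('I_N + 'I_N)%type.
Implicit Types (a b : J -> R) (A : set V).

Lemma C1_on_pcoord A k : open A -> C1_on A (pcoord k).
Proof.
move=> oA; have lin : linear (@pcoord R N k).
  by move=> c y z; case: k => i /=; rewrite !mxE.
pose lM := GRing.isLinear.Build _ _ _ _ (@pcoord R N k) lin.
pose L : {linear V -> R} := HB.pack (@pcoord R N k) lM.
by apply: (@C1_on_linear _ _ A L); exact: continuous_pcoord.
Qed.

(** A function of class C^1 that is positive exactly on the box. *)
Definition box_height a b (z : V) : R :=
  \prod_k (sqpos (pcoord k z - a k) * sqpos (b k - pcoord k z)).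

Lemma box_height_ge0 a b z : 0 <= box_height a b z.
Proof. by apply: prodr_ge0 => k _; rewrite mulr_ge0 ?sqpos_ge0. Qed.

Lemma box_height_eq0 a b z : box_height a b z = 0 <-> ~ box a b z.
Proof.
split=> [/eqP /prodf_eq0[k _]|nb].
  rewrite mulf_eq0 !sqpos_eq0 !subr_le0 => /orP[]; rewrite leNgt => /negP h zb;
      apply: h.
    by have /andP[] := zb k.
  by have /andP[] := zb k.
apply/eqP/prodf_eq0; apply: contrapT => h; apply: nb => k.
have : ~ (sqpos (pcoord k z - a k) * sqpos (b k - pcoord k z) == 0).
  by move=> k0; apply: h; exists k.
by move/negP; rewrite mulf_eq0 !sqpos_eq0 !subr_le0 negb_or -!ltNge.
Qed.

(** These test functions share one compact support, are bounded by 1 and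
    increase to the indicator function of the box. *)
Definition bump a b (n : nat) (z : V) : R :=
  1 - expR (- (n%:R * box_height a b z)).

Lemma bump_eq0 a b n z : ~ box a b z -> bump a b n z = 0.
Proof. by move=> /box_height_eq0; rewrite /bump => ->;
    rewrite mulr0 oppr0 expR0 subrr. Qed.

Lemma bump_norm_le1 a b n z : `|bump a b n z| <= 1.
Proof.
have e0 := expR_ge0 (- (n%:R * box_height a b z)).
have e1 : expR (- (n%:R * box_height a b z)) <= 1.
  by rewrite -expR0 ler_expR oppr_le0 mulr_ge0// box_height_ge0.
by rewrite /bump ger0_norm; lra.
Qed.

Lemma cvg_bump a b z : box a b z -> bump a b ^~ z @ \oo --> (1 : R).
Proof.
move=> zb; have h0 : 0 < box_height a b z.
  rewrite lt0r box_height_ge0 andbT; apply/eqP => /box_height_eq0; exact.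
pose q := expR (- box_height a b z).
rewrite (_ : bump a b ^~ z = fun n => 1 - q ^+ n); last first.
  by apply/funext => n; rewrite /bump -expRM_natl mulrN.
rewrite -[X in _ --> X](subr0 (1 : R)).
apply: cvgB; first exact: cvg_cst.
by apply: cvg_expr; rewrite ger0_norm ?expR_ge0// -expR0 ltr_expR oppr_lt0.
Qed.

Lemma C1_on_bump A a b n : open A -> C1_on A (bump a b n).
Proof.
move=> oA.
have Ch : C1_on A (box_height a b).
  have Cs f : C1_on A f -> C1_on A (sqpos \o f).
    exact: (C1_on_comp_real oA (@continuous_maxr0 R) (@is_derive_sqpos R)).
  apply: (@C1_on_prod _ _ _ oA) => k.
  apply: (C1_onM oA (f := sqpos \o (pcoord k - cst (a k)))
      (g := sqpos \o (cst (b k) - pcoord k))).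
    exact: Cs _ (C1_onB oA (C1_on_pcoord k oA) (@C1_on_cst _ _ A (a k))).
  exact: Cs _ (C1_onB oA (@C1_on_cst _ _ A (b k)) (C1_on_pcoord k oA)).
have Cm : C1_on A (cst (- n%:R) * box_height a b).
  exact: (C1_onM oA (@C1_on_cst _ _ A (- n%:R)) Ch).
have -> : bump a b n = cst 1 - (expR \o (cst (- n%:R) * box_height a b)).
  by apply/funext => z; rewrite /bump /= mulNr.
apply: (C1_onB oA (@C1_on_cst _ _ A 1)).
exact: (C1_on_comp_real oA (@continuous_expR R) (@is_derive_expR R)) Cm.
Qed.

Lemma C1c_bump (Omega : set 'rV[R]_N) a b n : open Omega ->
  cbox a b `<=` Omega `*` Omega -> C1c Omega (bump a b n).
Proof.
move=> oO ab; have sub : closure [set z | bump a b n z != 0] `<=` cbox a b.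
  rewrite closureE; apply: smallest_sub.
    by apply: compact_closed => //; exact: compact_cbox.
  move=> z /= /eqP h; apply: box_cbox; apply: contrapT => nb; apply: h.
  exact: bump_eq0.
split.
- by apply: C1_on_bump; exact: open_setX.
- apply: (@subclosed_compact _ _ (cbox a b)) => //; first exact: closed_closure.
  exact: compact_cbox.
- exact: subset_trans ab.
Qed.

End bump.

(** * The fundamental lemma of the calculus of variations *)

Section fundamental.
Context {R : realType} {N : nat}.
Local Notation V := ('rV[R]_N * 'rV[R]_N)%type.
Local Notation J := ('I_N + 'I_N)%type.
Local Notation lambda2 := (lebesgue_rV N \x lebesgue_rV N)%E.
Context (Omega : set 'rV[R]_N) (oOmega : open Omega).
Context (g : V -> R) (gL : L1loc2 Omega g).
Hypothesis g_test : forall psi, C1c Omega psi ->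
  \int[lambda2]_(z in Omega `*` Omega) (g z * psi z) = 0.
Implicit Types a b : J -> R.

Let mOO : measurable (Omega `*` Omega).
Proof. by apply: open_measurable_prV; exact: open_setX. Qed.

(** Dominated convergence along the bumps of the box: their integrals
    against g vanish and tend to the integral of g over the box. *)
Lemma integral_box_eq0 a b : cbox a b `<=` Omega `*` Omega ->
  (\int[lambda2]_(z in box a b) (g z)%:E = 0)%E.
Proof.
move=> ab; have [mg ig] := gL.
have {}ig := ig _ (@compact_cbox _ _ a b) ab.
have mcb := @measurable_cbox R N a b.
have mgc : measurable_fun (cbox a b) g by exact: measurable_funS mg.
have mbump n D : measurable_fun D (bump a b n).
  apply: measurable_funTS; apply: continuous_measurable_prV => z.
  by apply: (C1_on_continuous (C1_on_bump a b n openT)).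
have int0 n : (\int[lambda2]_(z in cbox a b) (g z * bump a b n z)%:E = 0)%E.
  have := g_test (C1c_bump n oOmega ab).
  have bc z : (Omega `*` Omega) z -> ~ cbox a b z -> g z * bump a b n z = 0.
    by move=> _ nz; rewrite bump_eq0 ?mulr0// => /box_cbox.
  rewrite (Rintegral_support _ ab bc) /Rintegral => /eqP.
  have I : lambda2.-integrable (cbox a b) (fun z => (g z * bump a b n z)%:E).
    apply: (@integrable_mul_test _ _ _ _ _ (cbox a b) _ _ _ _ _ 1) => //.
    by move=> z _; exact: bump_norm_le1.
  rewrite fine_eq0; first by move/eqP.
  exact: integrable_fin_num.
have [|||||_ _] := @dominated_convergence _ _ _ lambda2 (cbox a b) mcb
  (fun n z => (g z * bump a b n z)%:E) (fun z => (g z * \1_(box a b) z)%:E)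
  (fun z => `|(g z)%:E|%E).
- by move=> n; apply/measurable_EFinP; exact: measurable_funM.
- apply/measurable_EFinP; apply: measurable_funM => //.
  by apply: measurable_indic; exact: measurable_box.
- apply: nearW => z _; apply: cvg_EFin; first exact: nearW.
  apply: cvgM; first exact: cvg_cst.
  rewrite indicE; have [zb|nzb] := pselect (box a b z).
    by rewrite mem_set//; exact: cvg_bump.
  rewrite memNset//; apply: cvg_near_cst; apply: nearW => n.
  exact: bump_eq0.
- exact: integrable_abse.
- apply: nearW => z n _; rewrite lee_fin normrM ler_piMr//.
  exact: bump_norm_le1.
under eq_fun do rewrite int0.
move=> /(cvg_unique _ (cvg_cst 0%E))/esym E; apply: etrans (E _) => //.
transitivity (\int[lambda2]_(z in cbox a b `&` box a b) (g z)%:E)%E.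
  by rewrite (setIidr (@box_cbox _ _ a b)).
rewrite integral_mkcondr.
apply: eq_integral => z _; rewrite patchE indicE; case: ifP => zb.
  by rewrite mulr1.
by rewrite mulr0.
Qed.

(** Boxes form a pi-system that generates the sigma-algebra, and inside a
    fixed box g is integrable, so that the sets on which the integral of g
    vanishes form a Dynkin system. *)
Lemma integral_box_setI_eq0 a b (S : set V) : cbox a b `<=` Omega `*` Omega ->
  measurable S -> (\int[lambda2]_(z in box a b `&` S) (g z)%:E = 0)%E.
Proof.
move=> ab mS; have mb := @measurable_box R N a b.
have [mg ig] := gL; have {}ig := ig _ (@compact_cbox _ _ a b) ab.
have ib : lambda2.-integrable (box a b) (EFin \o g).
  exact: integrableS (@measurable_cbox R N a b) mb (@box_cbox _ _ a b) ig.
have ibS A : measurable A -> lambda2.-integrable (box a b `&` A) (EFin \o g).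
  by move=> mA; apply: integrableS ib => //; exact: measurableI.
apply: (dynkin_induction
  (P := fun S => \int[lambda2]_(z in box a b `&` S) (g z)%:E = 0)%E
  measurable_prV_boxes setI_closed_boxes);
      last by rewrite -measurable_prV_boxes.
- by rewrite setIT; exact: integral_box_eq0.
- move=> _ [[c d] _ <-]; rewrite setI_box/=.
  apply: integral_box_eq0; apply: subset_trans ab => z zb k.
  by have := zb k; rewrite ge_max le_min => /andP[/andP[-> _] /andP[-> _]].
- move=> {mS}S mS S0.
  have := @integral_setU _ _ _ lambda2 (box a b `&` S) (box a b `&` ~` S)
      (EFin \o g).
  rewrite -setIUr setUv setIT integral_box_eq0// S0 add0e => <- //.
  + exact: measurableI.
  + by apply: measurableI => //; exact: measurableC.
  + exact: measurable_int ib.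
  + by apply/disj_setPS => z [[_ ?] [_ ?]].
- move=> F mF tF F0; rewrite setI_bigcupr integral_bigcup//.
  + by rewrite eseries0.
  + exact: trivIset_setIl.
  + by move=> k; exact: measurableI.
  + by rewrite -setI_bigcupr; apply: ibS; exact: bigcupT_measurable.
Qed.

(** The square of Omega is covered by countably many rational boxes whose
    closures it contains, and g vanishes almost everywhere in each, since
    its integral over every measurable subset of the box is 0. *)
Lemma fundamental_lemma : {ae lambda2, forall z, (Omega `*` Omega) z -> g z =
    0}.
Proof.
pose B (ab : {ffun J -> rat} * {ffun J -> rat}) : set V :=
  box (fun k => ratr (ab.1 k)) (fun k => ratr (ab.2 k)).
pose cB (ab : {ffun J -> rat} * {ffun J -> rat}) : set V :=
  cbox (fun k => ratr (ab.1 k)) (fun k => ratr (ab.2 k)).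
suff : {ae lambda2, forall z, forall n : nat, forall ab, unpickle n = Some ab ->
    cB ab `<=` Omega `*` Omega -> B ab z -> g z = 0}.
  apply: filterS => z h zO; have [ab [zB BO]] :=
      box_in_open (open_setX oOmega oOmega) zO.
  by apply: (h (pickle ab) ab) => //; exact: pickleK.
apply: ae_foralln => n.
case: (unpickle n) => [ab|]; last by apply: nearW.
have [cBO|nB] := pselect (cB ab `<=` Omega `*` Omega); last first.
  by apply: nearW => z _ [<-].
have [mg ig] := gL.
have mb : measurable (B ab) by exact: measurable_box.
have : ae_eq lambda2 (B ab) (EFin \o g) (cst 0%E).
  apply: integral_ae_eq => //.
    apply: integrableS (ig _ (@compact_cbox _ _ _ _) cBO) => //.
      exact: measurable_cbox.
    exact: box_cbox.
  move=> E EB mE; rewrite integral0 -(setIidr EB).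
  exact: integral_box_setI_eq0.
by apply: filterS => z h _ [<-] _ /h[].
Qed.

End fundamental.

(** * The adjoint of the nonlocal derivative *)

Section adjoint.
Context {R : realType} {N : nat}.
Local Notation V := ('rV[R]_N * 'rV[R]_N)%type.
Local Notation lambda := (lebesgue_rV N : {measure set 'rV[R]_N -> \bar R}).
Local Notation lambda2 := (lebesgue_rV N \x lebesgue_rV N)%E.

(** Extension by zero: f is continuous on an open set that contains its
    closed support. *)
Lemma continuous_glue (T : topologicalType) (A S : set T) (f : T -> R) :
  open A -> closed S -> S `<=` A -> (forall z, A z -> {for z, continuous f}) ->
  (forall z, ~ S z -> f z = 0) -> continuous f.
Proof.
move=> oA cS SA cf f0 z; have [Sz|nSz] := pselect (S z); first exact/cf/SA.
apply: (@near_eq_continuous _ _ _ (cst 0)); last exact: cst_continuous.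
apply: filterS (open_nbhs_nbhs (conj (closed_openC cS) nSz)) => z' ?.
exact: f0.
Qed.

Definition swap_prV (z : V) : V := (z.2, z.1).

Lemma C1_on_comp_swap (A : set V) f : open A ->
    (forall z, A z -> A (swap_prV z)) ->
  C1_on A f -> C1_on A (f \o swap_prV).
Proof.
move=> oA As Cf; have lin : linear swap_prV by move=> c [x y] [x' y'].
pose lM := GRing.isLinear.Build _ _ _ _ swap_prV lin.
pose L : {linear V -> V} := HB.pack swap_prV lM.
apply: (@C1_on_comp_linear _ _ A f L) => //.
exact: swap_continuous.
Qed.

Context (Omega : set 'rV[R]_N) (oOmega : open Omega) (omega : V -> R).
Hypothesis omega_adm : admissible_weight Omega omega.
Context (i : 'I_N) (psi : V -> R) (psiC : C1c Omega psi).

Let OO := Omega `*` Omega.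
Let oOO : open OO. Proof. exact: open_setX. Qed.
Let S := closure [set z | psi z != 0].

(** The function whose partial derivative in x is the integrand of the
    adjoint operator. Unlike omega, it is of class C^1 on the whole space,
    for it vanishes off the compact square K `*` K below. *)
Definition weighted_skew (z : V) : R := omega z * (psi (swap_prV z) - psi z).

Lemma C1_on_weighted_skew : C1_on OO weighted_skew.
Proof.
have [Cpsi _ _] := psiC; have [_ Comega _] := omega_adm.
have Cs : C1_on OO (psi \o swap_prV).
  by apply: (C1_on_comp_swap oOO _ Cpsi) => z [? ?]; split.
exact: (C1_onM oOO Comega (C1_onB oOO Cs Cpsi)).
Qed.

(** Both projections are needed since psi enters the adjoint through psi
    (x, y) and through psi (y, x). *)
Definition adjoint_support : set 'rV[R]_N := fst @` S `|` snd @` S.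
Local Notation K := adjoint_support.

Lemma compact_adjoint_support : compact K.
Proof.
have [_ cS _] := psiC.
apply: compactU; apply: continuous_compact => //;
    apply: continuous_subspaceT => z.
  exact: cvg_fst.
exact: cvg_snd.
Qed.

Lemma adjoint_support_sub : K `<=` Omega.
Proof. by have [_ _ SO] := psiC; move=> x [] [z /SO[? ?] <-]. Qed.

Let cKK : compact (K `*` K).
Proof. by apply: compact_setX; exact: compact_adjoint_support. Qed.

Let KK_OO : K `*` K `<=` OO.
Proof. by move=> z [/= ? ?]; split; exact: adjoint_support_sub. Qed.

Let closedKK : closed (K `*` K).
Proof. exact: compact_closed. Qed.

Lemma weighted_skew_eq0 z : ~ (K `*` K) z -> weighted_skew z = 0.
Proof.
move=> nz; have psi0 z' : ~ S z' -> psi z' = 0.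
  by move=> nS; apply: contrapT => /eqP h; apply: nS; exact: subset_closure.
rewrite /weighted_skew !psi0 ?subrr ?mulr0// => Sz; apply: nz.
  by split; [left|right]; exists z.
by split; [right|left]; exists (swap_prV z).
Qed.

Let v : V := (delta_mx 0 i, 0).

Definition skew_derivative (z : V) : R := 'D_v weighted_skew z.
Local Notation H := skew_derivative.

Lemma skew_derivative_eq0 z : ~ (K `*` K) z -> H z = 0.
Proof.
move=> nz; rewrite /H (near_eq_derive (g := cst 0)) ?derive_cst//.
apply: filterS (open_nbhs_nbhs (conj (closed_openC closedKK) nz)) => z' ?.
exact: weighted_skew_eq0.
Qed.

(** Continuous on the square of Omega by the C^1 hypotheses, and zero off a
    compact subset. *)
Lemma continuous_skew_derivative : continuous H.
Proof.
apply: (continuous_glue oOO closedKK KK_OO); last exact: skew_derivative_eq0.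
move=> z OOz; have [_ cW] := C1_on_weighted_skew OOz.
apply: (@near_eq_continuous _ _ _ (fun z' => 'd weighted_skew z' v));
    last exact: cW.
apply: filterS (open_nbhs_nbhs (conj oOO OOz)) => z' OOz'.
by have [dW _] := C1_on_weighted_skew OOz'; exact: (deriveE v dW).
Qed.

Let mH : measurable_fun [set: V] H.
Proof. exact: (continuous_measurable_prV continuous_skew_derivative). Qed.

Lemma skew_derivative_bounded : exists C, 0 <= C /\ forall z, `|H z| <= C.
Proof.
have : bounded_set (H @` (K `*` K)).
  apply: compact_bounded; apply: continuous_compact => //.
  exact: (continuous_subspaceT continuous_skew_derivative).
move=> /ex_strict_bound_gt0[C C0 HC]; exists C; split; first exact: ltW.
move=> z; have [Kz|nKz] := pselect ((K `*` K) z).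
  by apply/ltW/HC; exists z.
by rewrite skew_derivative_eq0// normr0 ltW.
Qed.

Let mK : measurable K. Proof. exact:
    (compact_measurable_rV compact_adjoint_support). Qed.

(** The partial derivative in x is the directional derivative on the
    product along (e_i, 0), and only y in K contributes. *)
Lemma nl_partial_adjointE x :
  nl_partial_adjoint Omega omega i psi x = \int[lambda]_(y in K) H (x, y).
Proof.
rewrite /nl_partial_adjoint -(Rintegral_support lambda adjoint_support_sub);
    last first.
  by move=> y _ nKy; rewrite skew_derivative_eq0// => -[].
apply: eq_Rintegral => y _; rewrite /H /derive/=; congr (lim _).
suff -> : (fun h : R => h^-1 *:
    (weighted_skew (h *: v + (x, y)) - weighted_skew (x, y)))
  = (fun h : R => h^-1 *: (omega (h *: delta_mx 0 i + x, y) *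
      (psi (y, h *: delta_mx 0 i + x) - psi (h *: delta_mx 0 i + x, y)) -
      omega (x, y) * (psi (y, x) - psi (x, y)))) by [].
apply/funext => h.
have -> : h *: v + (x, y) = (h *: delta_mx 0 i + x, y).
  transitivity (h *: delta_mx 0 i + x, h *: 0 + y); first by [].
  by rewrite scaler0 add0r.
by [].
Qed.

(** Part of Fubini's theorem, for an integrand that is bounded with compact
    support. *)
Lemma measurable_nl_partial_adjoint :
  measurable_fun [set: 'rV[R]_N] (nl_partial_adjoint Omega omega i psi).
Proof.
have iH : lambda2.-integrable [set: V] (EFin \o H).
  have -> : EFin \o H = (fun z => (1 * H z)%:E) by apply/funext => z /=;
      rewrite mul1r.
  have [C [_ HC]] := skew_derivative_bounded.
  apply: (@integrable_mul_test _ _ _ _ _ (K `*` K) _ _ _ (cst 1) _ C) => //.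
  - exact: measurableX.
  - apply: measurable_bounded_integrable => //.
    + exact: measurableX.
    + exact: (lebesgue2_setX compact_adjoint_support).
    + by exists 1; split => // M M1 z _; rewrite /= normr1 ltW.
  - by move=> z _; exact: skew_derivative_eq0.
rewrite (_ : nl_partial_adjoint _ _ _ _ =
    fine \o fubini_F (lebesgue_rV N) (EFin \o H)).
  apply: (@measurableT_comp _ _ _ _ _ _ fine) => //.
  exact: (measurable_fubini_F iH).
apply/funext => x; rewrite nl_partial_adjointE
    -(Rintegral_support lambda (@subsetT _ K))//.
by move=> y _ nKy; rewrite skew_derivative_eq0// => -[].
Qed.

Lemma nl_partial_adjoint_eq0 x : ~ K x ->
    nl_partial_adjoint Omega omega i psi x = 0.
Proof.
move=> nKx; rewrite nl_partial_adjointE /Rintegral integral0_eq// => y _.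
by rewrite skew_derivative_eq0// => -[].
Qed.

Lemma nl_partial_adjoint_bounded :
  exists C, forall x, `|nl_partial_adjoint Omega omega i psi x| <= C.
Proof.
have [C [C0 HC]] := skew_derivative_bounded.
have Koo : (lambda K < +oo)%E by exact:
    (lebesgue_rV_compact compact_adjoint_support).
exists (C * fine (lambda K)) => x; rewrite nl_partial_adjointE.
have iH : lambda.-integrable K (EFin \o (fun y => H (x, y))).
  apply: measurable_bounded_integrable => //.
    by apply: measurable_funTS; exact: measurableT_comp.
  by exists C; split; [exact: num_real|move=> M CM y _;
      exact: le_trans (ltW CM)].
apply: (le_trans (le_normr_Rintegral _ iH)) => //.
rewrite -Rintegral_cst//; apply: le_Rintegral => //.
  exact: integrable_norm.
by apply: measurable_bounded_integrable => //; exists C; split;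
    [exact: num_real|move=> M CM y _; rewrite /= ger0_norm// ltW].
Qed.

End adjoint.

(** * Limits of integrals against test functions *)

Section test_convergence.
Context d (T : measurableType d) (R : realType)
    (mu : {measure set T -> \bar R}).
Context (D K : set T) (mD : measurable D) (mK : measurable K) (KD : K `<=` D).
Hypothesis Koo : (mu K < +oo)%E.
Implicit Types (q : R) (w : T -> R).

(** Either |t| <= rho, or |t| / rho is at least 1 and below its q-th power.
    The first term is small on a set of finite measure, and the second is
    small if the q-energy is much smaller than rho `^ q. *)
Lemma norm_le_powR q (rho t : R) : 0 < rho -> 1 <= q ->
  `|t| <= rho + rho * (rho `^ q)^-1 * `|t| `^ q.
Proof.
move=> rho0 q1.
have rq0 : rho `^ q != 0 by rewrite gt_eqF// powR_gt0.
have -> : rho + rho * (rho `^ q)^-1 * `|t| `^ q = rho * (1 + (`|t| / rho) `^ q).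
  have -> : `|t| `^ q = (`|t| / rho) `^ q * rho `^ q.
    by rewrite -powRM ?divr_ge0// ?ltW// divfK// gt_eqF.
  by field.
rewrite -ler_pdivrMl// mulrC.
have [t1|/ltW t1] := leP (`|t| / rho) 1.
  by rewrite (le_trans t1)// lerDl powR_ge0.
by apply: (le_trans (le1r_powR t1 q1)); rewrite lerDr.
Qed.

Let r n : R := (2 ^ n.+1)%:R^-1.
Let r0 n : 0 < r n. Proof. by rewrite invr_gt0 ltr0n expn_gt0. Qed.

Lemma integrable_normpow_restr q w : measurable_fun D w ->
  (\int[mu]_(x in D) (`|w x| `^ q)%:E < +oo)%E ->
  mu.-integrable K (fun x => (`|w x| `^ q)%:E).
Proof.
move=> mw wq; apply: (@integrableS _ _ _ _ D) => //; apply/integrableP; split.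
  by apply/measurable_EFinP; exact: measurable_norm_powR.
by under eq_integral do rewrite gee0_abs ?lee_fin ?powR_ge0//.
Qed.

Let integrable_majorant q w n : measurable_fun D w ->
  (\int[mu]_(x in D) (`|w x| `^ q)%:E < +oo)%E ->
  mu.-integrable K (EFin \o (fun x => r n + r n * (r n `^ q)^-1 * `|w x| `^ q)).
Proof.
move=> mw wq; apply: (@integrableD _ _ _ mu K mK (EFin \o cst (r n))
    (EFin \o (fun x => r n * (r n `^ q)^-1 * `|w x| `^ q))).
  apply: measurable_bounded_integrable => //.
  by exists `|r n|; split; [exact: num_real|move=> M CM y _; exact: ltW].
have := integrableZl mK (r n * (r n `^ q)^-1) (integrable_normpow_restr mw wq).
by apply: eq_integrable => // x _; rewrite /= EFinM.
Qed.

Lemma Lp_integrable_restr q w : 1 <= q -> measurable_fun D w ->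
  (\int[mu]_(x in D) (`|w x| `^ q)%:E < +oo)%E -> mu.-integrable K (EFin \o w).
Proof.
move=> q1 mw wq; apply: le_integrable (integrable_majorant 0 mw wq) => //.
  by apply/measurable_EFinP; exact: measurable_funS mw.
move=> x Kx; rewrite /= lee_fin (le_trans (norm_le_powR (w x) (r0 0) q1))//.
exact: ler_norm.
Qed.

(** On a set of finite measure, closeness in q-energy gives closeness in
    mean; norm_le_powR with rho = r n avoids the inequality of Hoelder. *)
Lemma Rintegral_norm_rate q w n : 1 <= q -> measurable_fun D w ->
  (\int[mu]_(x in D) (`|w x| `^ q)%:E <= (rate q n)%:E)%E ->
  \int[mu]_(x in K) `|w x| <= r n * (fine (mu K) + 1).
Proof.
move=> q1 mw wr.
have wq : (\int[mu]_(x in D) (`|w x| `^ q)%:E < +oo)%E by exact: le_lt_trans wr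
    (ltry _).
have rq0 : r n `^ q != 0 by rewrite gt_eqF// powR_gt0.
apply: (@le_trans _ _ (\int[mu]_(x in K)
    (r n + r n * (r n `^ q)^-1 * `|w x| `^ q))).
  apply: le_Rintegral => //.
  - exact/integrable_norm/Lp_integrable_restr/wq.
  - exact: integrable_majorant.
  - by move=> x _; exact: norm_le_powR.
have iw := integrable_normpow_restr mw wq.
rewrite RintegralD//; last 2 first.
- apply: measurable_bounded_integrable => //.
  by exists `|r n|; split; [exact: num_real|move=> M CM y _; exact: ltW].
- have := integrableZl mK (r n * (r n `^ q)^-1) iw.
  by apply: eq_integrable => // x _; rewrite /= EFinM.
rewrite Rintegral_cst// RintegralZl// mulrDr lerD2l mulr1.
have rn1 : r n <= 1 by rewrite invf_le1 ?ltr0n ?expn_gt0// ler1n expn_gt0.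
have : \int[mu]_(x in K) (`|w x| `^ q) <= rate q n.
  rewrite -lee_fin fineK; last exact: integrable_fin_num.
  apply: le_trans wr; apply: ge0_subset_integral => //.
  by apply/measurable_EFinP; exact: measurable_norm_powR.
move=> h.
apply: (@le_trans _ _ (r n * (r n `^ q)^-1 * rate q n)).
  by rewrite ler_wpM2l// mulr_ge0 ?invr_ge0 ?powR_ge0// ltW.
rewrite /rate -/(r n) -mulrA (mulrCA _ (r n)) mulVf// mulr1.
by rewrite ler_piMl// ltW.
Qed.

(** Integrals against a bounded function supported in K pass to the limit,
    as they are dominated by the convergence in mean on K. *)
Lemma cvg_Rintegral_test q (f : nat -> T -> R) (w phi : T -> R) (C : R) : 1 <=
    q ->
  (forall n, measurable_fun D (f n)) -> measurable_fun D w ->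
      measurable_fun D phi ->
  (forall n, mu.-integrable K (EFin \o f n)) -> mu.-integrable K (EFin \o w) ->
  (forall x, D x -> `|phi x| <= C) -> (forall x, D x -> ~ K x -> phi x = 0) ->
  (forall n, \int[mu]_(x in D) (`|f n x - w x| `^ q)%:E <= (rate q n)%:E)%E ->
  \int[mu]_(x in D) (f n x * phi x) @[n --> \oo] -->
      \int[mu]_(x in D) (w x * phi x).
Proof.
move=> q1 mf mw mphi fi wi phiC phi0 fr.
have [->|/set0P[x0 Dx0]] := eqVneq D set0.
  by rewrite Rintegral_set0; under eq_fun do rewrite Rintegral_set0;
      exact: cvg_cst.
have C0 : 0 <= C by exact: le_trans (phiC _ Dx0).
have ifn n : mu.-integrable D (fun x => (f n x * phi x)%:E).
  exact: (integrable_mul_test mD mK KD (mf n) mphi (fi n) phiC phi0).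
have iw : mu.-integrable D (fun x => (w x * phi x)%:E).
  exact: (integrable_mul_test mD mK KD mw mphi wi phiC phi0).
have bound n : `|\int[mu]_(x in D) (w x * phi x) - \int[mu]_(x in D)
    (f n x * phi x)|
    <= C * (fine (mu K) + 1) * r n.
  have mfw : measurable_fun D (f n \- w) by exact: measurable_funB.
  have ifw : mu.-integrable K (EFin \o (f n \- w)).
    by have := integrableB mK (fi n) wi; apply: eq_integrable => // x _.
  have E : \int[mu]_(x in D) (f n x * phi x) - \int[mu]_(x in D) (w x * phi x) =
      \int[mu]_(x in K) (f n x * phi x - w x * phi x).
    rewrite -(@RintegralB _ _ _ mu D (fun x => f n x * phi x)
        (fun x => w x * phi x) mD (ifn n) iw).
    apply: (Rintegral_support mu KD (F := fun x => f n x * phi x - w x * phi x))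
        => x Dx nKx.
    by rewrite (phi0 _ Dx nKx) !mulr0 subrr.
  rewrite distrC E.
  have ip : mu.-integrable K (EFin \o (fun x => f n x * phi x - w x * phi x)).
    have := integrableB mK (integrableS mD mK KD (ifn n))
        (integrableS mD mK KD iw).
    by apply: eq_integrable => // x _.
  apply: (le_trans (le_normr_Rintegral mK ip)).
  apply: (@le_trans _ _ (\int[mu]_(x in K) (C * `|f n x - w x|))).
    apply: le_Rintegral => //.
    + exact: integrable_norm.
    + have := integrableZl mK C (integrable_norm ifw).
      by apply: eq_integrable => // x _; rewrite /= EFinM.
    + move=> x Kx; rewrite -mulrBl normrM mulrC ler_wpM2r//; exact/phiC/KD.
  rewrite RintegralZl//; last by exact: integrable_norm ifw.
  by rewrite -mulrA ler_wpM2l// mulrC;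
      exact: (Rintegral_norm_rate q1 mfw (fr n)).
apply/cvgrPdist_le => e e0.
have : C * (fine (mu K) + 1) * r n @[n --> \oo] --> C * (fine (mu K) + 1) * 0.
  apply: cvgM; first exact: cvg_cst.
  have := @cvg_geometric R 2^-1 2^-1.
  rewrite ger0_norm// invf_lt1// ltr1n => /(_ isT).
  suff -> : r = geometric 2^-1 2^-1 by [].
  by apply/funext => n; rewrite /geometric/= /r natrX -exprVn exprS.
rewrite mulr0 => /cvgrPdist_le/(_ _ e0); apply: filterS => n.
rewrite sub0r normrN => h; apply: (le_trans (bound n));
    exact: le_trans (ler_norm _) h.
Qed.

End test_convergence.

(** * The weak nonlocal derivative *)

Section weak_derivative.
Context {R : realType} {N : nat}.
Local Notation V := ('rV[R]_N * 'rV[R]_N)%type.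
Local Notation lambda := (lebesgue_rV N : {measure set 'rV[R]_N -> \bar R}).
Local Notation lambda2 := (lebesgue_rV N \x lebesgue_rV N)%E.
Context (Omega : set 'rV[R]_N) (oOmega : open Omega) (omega : V -> R).
Hypothesis omega_adm : admissible_weight Omega omega.
Context (i : 'I_N).
Implicit Types (u v : 'rV[R]_N -> R) (g h psi : V -> R).

Let OO := Omega `*` Omega.
Let oOO : open OO. Proof. exact: open_setX. Qed.
Let mO : measurable Omega. Proof. exact: open_measurable_rV. Qed.
Let mOO : measurable OO. Proof. exact: open_measurable_prV. Qed.

Let supp psi := closure [set z | psi z != 0].

Lemma C1c_eq0 psi z : ~ supp psi z -> psi z = 0.
Proof. by move=> nS; apply: contrapT => /eqP h; apply: nS;
    exact: subset_closure. Qed.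

Lemma C1c_continuous psi : C1c Omega psi -> continuous psi.
Proof.
move=> [Cpsi cS SO]; apply: (continuous_glue oOO
    (@closed_closure _ [set z | psi z != 0]) SO).
  exact: C1_on_continuous Cpsi.
exact: C1c_eq0.
Qed.

Lemma C1c_bounded psi : C1c Omega psi -> exists C, forall z, `|psi z| <= C.
Proof.
move=> Cpsi; have [_ cS _] := Cpsi.
have : bounded_set (psi @` supp psi).
  apply: compact_bounded; apply: continuous_compact => //.
  exact: (continuous_subspaceT (C1c_continuous Cpsi)).
move=> /ex_strict_bound_gt0[C C0 HC]; exists C => z.
have [Sz|nSz] := pselect (supp psi z); first by apply/ltW/HC; exists z.
by rewrite C1c_eq0// normr0 ltW.
Qed.

Lemma measurable_C1c psi (D : set V) : C1c Omega psi -> measurable_fun D psi.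
Proof.
move=> Cpsi; apply: measurable_funTS.
exact: (continuous_measurable_prV (C1c_continuous Cpsi)).
Qed.

Lemma integrable_adjoint u psi : L1loc Omega u -> C1c Omega psi ->
  lambda.-integrable Omega (fun x =>
      (u x * nl_partial_adjoint Omega omega i psi x)%:E).
Proof.
move=> [mu ui] Cpsi; have [C HC] :=
    nl_partial_adjoint_bounded oOmega omega_adm i Cpsi.
have cK := compact_adjoint_support Cpsi; have KO := adjoint_support_sub Cpsi.
apply: (@integrable_mul_test _ _ _ lambda _ (adjoint_support psi) _ _ _ _ _ C)
    => //.
- exact: compact_measurable_rV.
- by apply: measurable_funTS; exact: measurable_nl_partial_adjoint.
- exact: ui.
- by move=> x _; exact: nl_partial_adjoint_eq0.
Qed.

Lemma integrable_C1c g psi : L1loc2 Omega g -> C1c Omega psi ->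
  lambda2.-integrable OO (fun z => (g z * psi z)%:E).
Proof.
move=> [mg gi] Cpsi; have [C HC] := C1c_bounded Cpsi; have [_ cS SO] := Cpsi.
apply: (@integrable_mul_test _ _ _ lambda2 _ (supp psi) _ _ _ _ _ C) => //.
- exact: compact_measurable_prV.
- exact: measurable_C1c.
- exact: gi.
- by move=> z _; exact: C1c_eq0.
Qed.

Lemma is_nl_partial_lincomb (a b : R) u v g h :
  is_nl_partial Omega omega i u g -> is_nl_partial Omega omega i v h ->
  is_nl_partial Omega omega i (fun x => a * u x + b * v x)
      (fun z => a * g z + b * h z).
Proof.
move=> [Lu Lg ug] [Lv Lh vh]; split.
- split; first by apply: measurable_funD; apply: measurable_funM => //;
    [case: Lu|case: Lv].
  move=> K cK KO; have mK := compact_measurable_rV cK.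
  have := integrableD mK (integrableZl mK a (Lu.2 K cK KO))
      (integrableZl mK b (Lv.2 K cK KO)).
  by apply: eq_integrable => // x _.
- split; first by apply: measurable_funD; apply: measurable_funM => //;
    [case: Lg|case: Lh].
  move=> K cK KO; have mK := compact_measurable_prV cK.
  have := integrableD mK (integrableZl mK a (Lg.2 K cK KO))
      (integrableZl mK b (Lh.2 K cK KO)).
  by apply: eq_integrable => // x _.
- move=> psi Cpsi.
  have iu := integrable_adjoint Lu Cpsi; have iv := integrable_adjoint Lv Cpsi.
  have ig := integrable_C1c Lg Cpsi; have ih := integrable_C1c Lh Cpsi.
  set phi := nl_partial_adjoint Omega omega i psi in iu iv *.
  have lin d (T : measurableType d) (mu : {measure set T -> \bar R}) (D : set T)
      (f1 f2 w : T -> R) : measurable D ->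
      mu.-integrable D (fun x => (f1 x * w x)%:E) ->
      mu.-integrable D (fun x => (f2 x * w x)%:E) ->
      \int[mu]_(x in D) ((a * f1 x + b * f2 x) * w x) =
      a * \int[mu]_(x in D) (f1 x * w x) + b * \int[mu]_(x in D) (f2 x * w x).
    move=> mD i1 i2.
    rewrite -(RintegralZl _ mD i1) -(RintegralZl _ mD i2).
    rewrite -(@RintegralD _ _ _ mu D (fun x => a * (f1 x * w x))
        (fun x => b * (f2 x * w x)) mD).
    + by apply: eq_Rintegral => x _; ring.
    + by have := integrableZl mD a i1; apply: eq_integrable => // x _.
    + by have := integrableZl mD b i2; apply: eq_integrable => // x _.
  rewrite (lin _ _ _ _ _ _ _ mO iu iv) (lin _ _ _ _ _ _ _ mOO ig ih).
  by rewrite /phi ug// vh// opprD !mulrN.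
Qed.

Lemma is_nl_partial0 : is_nl_partial Omega omega i (cst 0) (cst 0).
Proof.
split.
- split => // K cK _; apply: measurable_bounded_integrable => //.
  + exact: compact_measurable_rV.
  + exact: lebesgue_rV_compact.
  + by exists 0; split => // M M0 x _; rewrite /= normr0 ltW.
- split => // K cK _; apply: measurable_bounded_integrable => //.
  + exact: compact_measurable_prV.
  + exact: lebesgue2_compact.
  + by exists 0; split => // M M0 x _; rewrite /= normr0 ltW.
- move=> psi _; rewrite /Rintegral !integral0_eq ?oppr0//.
  + by move=> z _; rewrite mul0r.
  + by move=> z _; rewrite mul0r.
Qed.

(** The difference of two weak derivatives integrates to 0 against every
    test function. *)
Lemma is_nl_partial_unique u g h : is_nl_partial Omega omega i u g ->
  is_nl_partial Omega omega i u h -> {ae lambda2, forall z, OO z -> g z = h z}.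
Proof.
move=> ug uh; have [_ Lg gu] := ug; have [_ Lh hu] := uh.
have [_ Ld _] := is_nl_partial_lincomb 1 (-1) ug uh.
have : {ae lambda2, forall z, OO z -> 1 * g z + -1 * h z = 0}.
  apply: (fundamental_lemma oOmega Ld) => psi Cpsi.
  have ig := integrable_C1c Lg Cpsi; have ih := integrable_C1c Lh Cpsi.
  have /eqP : - (\int[lambda2]_(z in OO) (g z * psi z)) =
      - (\int[lambda2]_(z in OO) (h z * psi z)).
    by rewrite -gu// hu.
  rewrite eqr_opp -subr_eq0 -(@RintegralB _ _ _ lambda2 OO
      (fun z => g z * psi z) (fun z => h z * psi z) mOO ig ih).
  move=> /eqP E; rewrite -[RHS]E; apply: eq_Rintegral => z _; ring.
apply: filterS => z hz OOz; have := hz OOz.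
by move/eqP; rewrite mul1r mulN1r subr_eq0 => /eqP.
Qed.

(** Both sides of the identity that defines the weak derivative pass to the
    limit: psi and its adjoint are bounded, with supports of finite
    measure. *)
Lemma is_nl_partial_closed (p q : R) (U : nat -> 'rV[R]_N -> R)
    (G : nat -> V -> R) u g :
  1 <= p -> 1 <= q ->
  (forall n, is_nl_partial Omega omega i (U n) (G n)) ->
  measurable_fun Omega u -> measurable_fun OO g ->
  (\int[lambda]_(x in Omega) (`|u x| `^ q)%:E < +oo)%E ->
  (\int[lambda2]_(z in OO) (`|g z| `^ p)%:E < +oo)%E ->
  (forall n, \int[lambda]_(x in Omega) (`|U n x - u x| `^ q)%:E <=
      (rate q n)%:E)%E ->
  (forall n, \int[lambda2]_(z in OO) (`|G n z - g z| `^ p)%:E <=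
      (rate p n)%:E)%E ->
  is_nl_partial Omega omega i u g.
Proof.
move=> p1 q1 UG mu mg uq gp ur gr.
have Lu : L1loc Omega u.
  split=> // K cK KO; apply: (Lp_integrable_restr mO _ KO _ q1 mu uq).
    exact: compact_measurable_rV.
  exact: lebesgue_rV_compact.
have Lg : L1loc2 Omega g.
  split=> // K cK KO; apply: (Lp_integrable_restr mOO _ KO _ p1 mg gp).
    exact: compact_measurable_prV.
  exact: lebesgue2_compact.
split => // psi Cpsi; set phi := nl_partial_adjoint Omega omega i psi.
have cl : \int[lambda]_(x in Omega) (U n x * phi x) @[n --> \oo] -->
    \int[lambda]_(x in Omega) (u x * phi x).
  have [C HC] := nl_partial_adjoint_bounded oOmega omega_adm i Cpsi.
  have cK := compact_adjoint_support Cpsi; have KO := adjoint_support_sub Cpsi.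
  apply: (@cvg_Rintegral_test _ _ _ lambda _ (adjoint_support psi) mO _ KO _ q _
      _ _ C) => //.
  - exact: compact_measurable_rV.
  - exact: lebesgue_rV_compact.
  - by move=> n; have [[]] := UG n.
  - by apply: measurable_funTS; exact: measurable_nl_partial_adjoint.
  - by move=> n; have [[_ h] _ _] := UG n; exact: h.
  - by case: Lu => _; exact.
  - by move=> x _; exact: nl_partial_adjoint_eq0.
have cr : \int[lambda2]_(z in OO) (G n z * psi z) @[n --> \oo] -->
    \int[lambda2]_(z in OO) (g z * psi z).
  have [C HC] := C1c_bounded Cpsi; have [_ cS SO] := Cpsi.
  apply: (@cvg_Rintegral_test _ _ _ lambda2 _ (supp psi) mOO _ SO _ p _ _ _ C)
      => //.
  - exact: compact_measurable_prV.
  - exact: lebesgue2_compact.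
  - by move=> n; have [_ []] := UG n.
  - exact: measurable_C1c.
  - by move=> n; have [_ [_ h] _] := UG n; exact: h.
  - by case: Lg => _; exact.
  - by move=> z _; exact: C1c_eq0.
have E : (fun n => \int[lambda]_(x in Omega) (U n x * phi x)) =
    (fun n => - (\int[lambda2]_(z in OO) (G n z * psi z))).
  by apply/funext => n; have [_ _ h] := UG n; exact: h.
rewrite E in cl; exact: (cvg_unique _ cl (cvgN cr)).
Qed.

End weak_derivative.

(** * Energies and the Dirichlet functional *)

Section mrestr_integral.
Context d (T : measurableType d) (R : realType)
    (mu : {measure set T -> \bar R}).

Lemma ge0_integral_mrestr (D : set T) (mD : measurable D) (f : T -> \bar R) :
  measurable_fun setT f -> (forall x, 0 <= f x)%E ->
  (\int[mrestr mu mD]_x f x = \int[mu]_(x in D) f x)%E.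
Proof.
move=> mf f0.
rewrite (@ge0_negligible_integral _ _ _ (mrestr mu mD) setT (~` D))//;
    last first.
- by rewrite -[LHS]/(mu (~` D `&` D)) setICl measure0.
- exact: measurableC.
rewrite setTD setCK; apply: eq_measure_integral => A mA AD.
by rewrite -[LHS]/(mu (A `&` D)) setIidl.
Qed.

End mrestr_integral.

Section Lq_energy.
Context d (T : measurableType d) (R : realType)
    (mu : {measure set T -> \bar R}).
Context (q : R) (q0 : 0 < q).
Implicit Types f : T -> R.

Lemma Lnorm_powR_energy f :
  ('N[mu]_q%:E[EFin \o f] `^ q = \int[mu]_x (`|f x| `^ q)%:E)%E.
Proof. by rewrite poweR_Lnorm ?gt_eqF. Qed.

Lemma Lfun_energy f : f \in Lfun mu q%:E <->
  measurable_fun setT f /\ (\int[mu]_x (`|f x| `^ q)%:E < +oo)%E.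
Proof.
rewrite -Lnorm_powR_energy inE; split.
  by move=> /andP[]; rewrite !inE/= => mf ff; split => //; exact: poweR_lty.
move=> [mf ff]; apply/andP; split; rewrite inE//=.
by apply: lty_poweRy ff; rewrite gt_eqF.
Qed.

(** Norms are traded for energies, which need no root and behave additively
    under the integral sign. *)
Lemma Lnorm_le f (k : R) : 0 <= k ->
  ('N[mu]_q%:E[EFin \o f] <= k%:E)%E =
      (\int[mu]_x (`|f x| `^ q)%:E <= (k `^ q)%:E)%E.
Proof.
move=> k0; rewrite -Lnorm_powR_energy -poweR_EFin.
have N0 := Lnorm_ge0 mu q%:E (EFin \o f).
have mono (r : R) (x y : \bar R) : 0 <= r -> (0 <= x)%E -> (x <= y)%E ->
    (x `^ r <= y `^ r)%E.
  move=> r0 x0 xy; apply: gt0_ler_poweR => //; rewrite in_itv/= leey andbT//.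
  exact: le_trans xy.
apply/idP/idP; first by apply: mono => //; exact: ltW.
move=> h; have := @mono q^-1 _ _ _ (poweR_ge0 _ _) h.
rewrite -!poweRrM mulfV ?gt_eqF// !poweRe1 ?lee_fin//; apply.
by rewrite invr_ge0 ltW.
Qed.

End Lq_energy.

Section dirichlet.
Context {R : realType} {N : nat}.
Local Notation V := ('rV[R]_N * 'rV[R]_N)%type.
Local Notation lambda := (lebesgue_rV N : {measure set 'rV[R]_N -> \bar R}).
Local Notation lambda2 := (lebesgue_rV N \x lebesgue_rV N)%E.
Context (Omega : set 'rV[R]_N) (oOmega : open Omega) (omega : V -> R).
Hypothesis omega_adm : admissible_weight Omega omega.
Implicit Types (u v : 'rV[R]_N -> R) (p : R).

Let OO := Omega `*` Omega.
Let mOO : measurable OO.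
Proof. by apply: open_measurable_prV; exact: open_setX. Qed.

Definition nl_grad u (z : V) : 'rV[R]_N := \row_i nl_partial Omega omega i u z.

Lemma nl_partialP u i : (exists g, is_nl_partial Omega omega i u g) ->
  is_nl_partial Omega omega i u (nl_partial Omega omega i u).
Proof. by move=> [g gP]; apply: (xgetPex (cst 0)); exists g. Qed.

Lemma nl_dirichletE p u :
  nl_dirichlet Omega omega p u =
      (\int[lambda2]_(z in OO) (enorm (nl_grad u z) `^ p)%:E)%E.
Proof.
apply: eq_integral => z _; rewrite /nl_grad_norm /enorm; congr (_ `^ _)%:E.
by congr Num.sqrt; apply: eq_bigr => i _; rewrite mxE.
Qed.

Lemma nl_dirichlet_ge0 p u : (0 <= nl_dirichlet Omega omega p u)%E.
Proof. by apply: integral_ge0 => z _; rewrite lee_fin powR_ge0. Qed.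

(** The gradient is a chosen representative, so nothing is known of it
    pointwise; by uniqueness of weak derivatives any other one gives the
    same energy. *)
Lemma nl_dirichlet_eq p u (g : V -> 'rV[R]_N) :
  (forall i, is_nl_partial Omega omega i u (fun z => g z ord0 i)) ->
  nl_dirichlet Omega omega p u =
      (\int[lambda2]_(z in OO) (enorm (g z) `^ p)%:E)%E.
Proof.
move=> gP; rewrite nl_dirichletE.
have uP i : is_nl_partial Omega omega i u (nl_partial Omega omega i u).
  by apply: nl_partialP; exists (fun z => g z ord0 i).
apply: ge0_ae_eq_integral => //.
- apply/measurable_EFinP; apply: measurable_enorm_powR => // i.
  rewrite (_ : (fun z => _) = nl_partial Omega omega i u); last first.
    by apply/funext => z; rewrite mxE.
  by have [_ []] := uP i.
- apply/measurable_EFinP; apply: measurable_enorm_powR => // i.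
  by have [_ []] := gP i.
- by move=> z _; rewrite lee_fin powR_ge0.
- by move=> z _; rewrite lee_fin powR_ge0.
have : {ae lambda2, forall z i, OO z -> nl_partial Omega omega i u z =
    g z ord0 i}.
  apply: filter_forall => i.
  exact: (is_nl_partial_unique oOmega omega_adm (uP i) (gP i)).
apply: filterS => z h OOz; congr (enorm _ `^ _)%:E.
by apply/rowP => i; rewrite mxE h.
Qed.

Lemma measurable_nl_grad u i : (exists g, is_nl_partial Omega omega i u g) ->
  measurable_fun OO (fun z => nl_grad u z ord0 i).
Proof.
move=> /nl_partialP[_ [mg _] _];
    rewrite (_ : (fun z => _) = nl_partial Omega omega i u)//.
by apply/funext => z; rewrite mxE.
Qed.

Lemma nl_partial_mid u v i : (exists g, is_nl_partial Omega omega i u g) ->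
  (exists g, is_nl_partial Omega omega i v g) ->
  is_nl_partial Omega omega i (fun x => 2^-1 * u x + (1 - 2^-1) * v x)
    (fun z => (2^-1 *: (nl_grad u z + nl_grad v z)) ord0 i).
Proof.
move=> /nl_partialP uP /nl_partialP vP.
have := is_nl_partial_lincomb oOmega omega_adm 2^-1 (1 - 2^-1) uP vP.
rewrite (_ : (fun z => 2^-1 * _ z + _) =
    (fun z => (2^-1 *: (nl_grad u z + nl_grad v z)) ord0 i))//.
by apply/funext => z; rewrite !mxE; lra.
Qed.

(** The chosen gradient of a midpoint is the midpoint of the chosen
    gradients only almost everywhere. *)
Lemma nl_dirichlet_mid p u v :
  (forall i, exists g, is_nl_partial Omega omega i u g) ->
  (forall i, exists g, is_nl_partial Omega omega i v g) ->
  nl_dirichlet Omega omega p (fun x => 2^-1 * u x + (1 - 2^-1) * v x) =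
  (\int[lambda2]_(z in OO) (enorm (2^-1 *: (nl_grad u z + nl_grad v z)) `^
      p)%:E)%E.
Proof.
move=> uP vP.
apply: (nl_dirichlet_eq p (g := fun z => 2^-1 *: (nl_grad u z + nl_grad v z)))
    => i.
exact: nl_partial_mid.
Qed.

Lemma nl_dirichlet_convex p u v : 1 < p ->
  (forall i, exists g, is_nl_partial Omega omega i u g) ->
  (forall i, exists g, is_nl_partial Omega omega i v g) ->
  (nl_dirichlet Omega omega p (fun x => 2^-1 * u x + (1 - 2^-1) * v x)%R <=
   2^-1%:E * nl_dirichlet Omega omega p u +
       2^-1%:E * nl_dirichlet Omega omega p v)%E.
Proof.
move=> p1 uP vP; rewrite nl_dirichlet_mid// !nl_dirichletE.
have h0 : 0 <= 2^-1 :> R by rewrite invr_ge0.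
have mu' : measurable_fun OO (fun z => enorm (nl_grad u z) `^ p).
  by apply: measurable_enorm_powR => // i; exact: measurable_nl_grad.
have mv' : measurable_fun OO (fun z => enorm (nl_grad v z) `^ p).
  by apply: measurable_enorm_powR => // i; exact: measurable_nl_grad.
rewrite -(ge0_integral_lincomb lambda2 mOO mu' mv' _ _ h0 h0); last 2 first.
- by move=> z; exact: powR_ge0.
- by move=> z; exact: powR_ge0.
apply: (@ge0_le_integral_EFin _ _ _ lambda2 OO mOO
  (fun z => enorm (2^-1 *: (nl_grad u z + nl_grad v z)) `^ p)
  (fun z => 2^-1 * enorm (nl_grad u z) `^ p + 2^-1 * enorm (nl_grad v z) `^ p)).
- apply: measurable_enorm_powR => // i.
  by have [_ []] := nl_partial_mid (uP i) (vP i).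
- exact: (measurable_funD (measurable_funM (measurable_cst _) mu')
    (measurable_funM (measurable_cst _) mv')).
- move=> z _; apply/andP; split; first exact: powR_ge0.
  by rewrite -mulrDr mulrC; exact:
      (enorm_powR_mid_le (nl_grad u z) (nl_grad v z) p1).
Qed.

End dirichlet.

(** * Minimization over nested sets *)

Section nested.
Context {R : realType}.

(** The infima of phi over the nested sets increase to a finite limit, so
    points that almost realize them have values that no point w of the
    larger set can undercut by much. With w a midpoint, the conclusion is
    the hypothesis of uniform convexity. *)
Lemma nested_minimizing (X : Type) (C : nat -> set X) (phi : X -> R) (B : R) :
  (forall n, C n !=set0) -> (forall n k, (n <= k)%N -> C k `<=` C n) ->
  (forall x, C 0%N x -> 0 <= phi x <= B) ->
  exists x : nat -> X, (forall n, C n (x n)) /\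
    forall del : R, 0 < del -> exists N0,
      forall n k, (N0 <= n)%N -> (n <= k)%N -> forall w, C n w ->
        phi (x n) + phi (x k) <= 2 * (phi w + del).
Proof.
move=> C0 CS phiB; pose s n := inf (phi @` C n).
have CS0 n x : C n x -> C 0%N x by exact: CS.
have hi n : has_inf (phi @` C n).
  split; first by have [x Cx] := C0 n; exists (phi x), x.
  by exists 0 => _ [x /CS0/phiB/andP[? _] <-].
have s_le n w : C n w -> s n <= phi w.
  by move=> Cw; apply: ge_inf; [exact: (hi n).2|exists w].
have s_nd : nondecreasing_seq s.
  move=> n k nk; apply: lb_le_inf; first exact: (hi k).1.
  by move=> _ [x Cx <-]; apply: s_le; exact: CS Cx.
have sB n : s n <= B.
  have [x Cx] := C0 n; apply: (le_trans (s_le _ _ Cx)).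
  by have /andP[] := phiB _ (CS0 _ _ Cx).
(* The tolerance 1 / (n + 1) tends to 0 together with the increments of the
   infima. *)
have /choice[x xP] : forall n, exists x, C n x /\ phi x < s n + n.+1%:R^-1.
  move=> n; have [|_ [x Cx <-] h] := @inf_adherent _ _ n.+1%:R^-1 _ (hi n).
    by rewrite invr_gt0.
  by exists x.
exists x; split=> [n|del d0]; first by have [] := xP n.
have s_cvg : cvgn s.
  by apply: nondecreasing_is_cvgn => //; exists B => _ [n _ <-].
have d20 : 0 < del / 2 by rewrite divr_gt0.
have [N1 _ HN1] := near_infty_natSinv_lt (PosNum d20).
have [N2 _ HN2] := (cvgrPdist_lt _ _).1 s_cvg _ d20.
exists (maxn N1 N2) => n k; rewrite geq_max => /andP[n1 n2] nk w Cw.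
have [_ xn] := xP n; have [_ xk] := xP k.
have hn : n.+1%:R^-1 < del / 2 by exact: HN1.
have hk : k.+1%:R^-1 < del / 2 by apply: HN1; exact: leq_trans nk.
have [L [sk sn]] : exists L : R, s k <= L /\ L - s n < del / 2.
  exists (limn s); split; first exact: nondecreasing_cvgn_le.
  exact: le_lt_trans (ler_norm _) (HN2 _ n2).
have sw := s_le _ _ Cw.
move: xn xk hn hk sk sn sw; move: n.+1%:R^-1 k.+1%:R^-1 (s n) (s k).
by move: (phi (x n)) (phi (x k)) (phi w) => a b c g h s1 s2; clear -d0; lra.
Qed.

(** Passing to a subsequence along which the n-th term lies beyond the
    threshold N0 n. *)
Lemma monotone_reindexing (N0 : nat -> nat) : exists sigma : nat -> nat,
  [/\ forall n k, (n <= k)%N -> (sigma n <= sigma k)%N, forall n,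
      (n <= sigma n)%N &
      forall n, (N0 n <= sigma n)%N].
Proof.
(* A sum dominates each of its terms and is monotone. *)
exists (fun n => n + \sum_(i < n.+1) N0 i)%N; split => [n k nk|n|n].
- rewrite leq_add// (big_ord_widen k.+1 N0) ?ltnS//.
  by rewrite [leqRHS](bigID (fun i : 'I_k.+1 => (i < n.+1)%N))/= leq_addr.
- exact: leq_addr.
- by rewrite big_ord_recr/= addnA leq_addl.
Qed.

End nested.

(** * Near-minimizers and their limit *)

Section scalar_uniform_convexity.
Context d (T : measurableType d) (R : realType)
    (mu : {measure set T -> \bar R}).
Context (D : set T) (mD : measurable D).

(** Scalar functions are maps into vectors of length one, so that uniform
    convexity is proved once. *)
Lemma enorm_row1 (a : R) : enorm (\row_(j < 1) a) = `|a|.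
Proof. by rewrite /enorm big_ord1 mxE sqrtr_sqr. Qed.

Lemma Lp_uniformly_convex_scalar (p M eps : R) : 1 < p -> 0 < M -> 0 < eps ->
  exists2 del : R, 0 < del & forall f g : T -> R,
    measurable_fun D f -> measurable_fun D g ->
    (\int[mu]_(x in D) (`|f x| `^ p)%:E <= M%:E)%E ->
    (\int[mu]_(x in D) (`|g x| `^ p)%:E <= M%:E)%E ->
    (\int[mu]_(x in D) (`|f x| `^ p)%:E + \int[mu]_(x in D) (`|g x| `^ p)%:E <=
      2%:E * (\int[mu]_(x in D) (`|2^-1 * (f x + g x)| `^ p)%:E + del%:E))%E ->
    (\int[mu]_(x in D) (`|f x - g x| `^ p)%:E <= eps%:E)%E.
Proof.
move=> p1 M0 e0.
have [del del0 H] := @Lp_uniformly_convex _ _ _ mu D mD 1 p M eps p1 M0 e0.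
exists del => // f g mf mg.
pose r (h : T -> R) x : 'rV[R]_1 := \row_(j < 1) h x.
have E (h : T -> R) : (\int[mu]_(x in D) (`|h x| `^ p)%:E =
    \int[mu]_(x in D) (enorm (r h x) `^ p)%:E)%E.
  by apply: eq_integral => x _; rewrite enorm_row1.
have mr h : measurable_fun D h -> forall i,
    measurable_fun D (fun x => r h x ord0 i).
  by move=> mh i; rewrite (_ : (fun _ => _) = h)//; apply/funext => x;
      rewrite mxE.
have := H _ _ (mr _ mf) (mr _ mg); rewrite -!E.
have -> : (\int[mu]_(x in D) (enorm (2^-1 *: (r f x + r g x)) `^ p)%:E =
    \int[mu]_(x in D) (`|2^-1 * (f x + g x)| `^ p)%:E)%E.
  apply: eq_integral => x _; rewrite -enorm_row1; congr (enorm _ `^ _)%:E.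
  by apply/rowP => j; rewrite !mxE.
have -> : (\int[mu]_(x in D) (enorm (r f x - r g x) `^ p)%:E =
    \int[mu]_(x in D) (`|f x - g x| `^ p)%:E)%E.
  apply: eq_integral => x _; rewrite -enorm_row1; congr (enorm _ `^ _)%:E.
  by apply/rowP => j; rewrite !mxE.
by [].
Qed.

End scalar_uniform_convexity.

Lemma cvg_norm_powR (R : realType) (r : R) (a : nat -> R) (l : R) : 0 < r ->
  a @ \oo --> l -> `|a n| `^ r @[n --> \oo] --> `|l| `^ r.
Proof.
move=> r0 al; have -> : (fun n => `|a n| `^ r) =
    (fun y => `|y| `^ r) \o a by [].
by apply: continuous_cvg => //; exact: continuous_norm_powR.
Qed.

Lemma cvg_coord_rV (R : realType) (k : nat) (a : nat -> 'rV[R]_k) (l : 'rV[R]_k)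
    :
  (forall i, a n ord0 i @[n --> \oo] --> l ord0 i) -> a @ \oo --> l.
Proof.
move=> al; apply/cvg_ballP => e e0.
have : \forall n \near \oo, forall i, ball (l ord0 i) e (a n ord0 i).
  by apply: filter_forall => i; exact: (cvg_ball (al i)).
by apply: filterS => n hn; split => // j i; rewrite (ord1 j); exact: hn.
Qed.

Lemma cvg_enorm_powR (R : realType) (k : nat) (r : R) (a : nat -> 'rV[R]_k)
    (l : 'rV[R]_k) : 0 < r ->
  a @ \oo --> l -> enorm (a n) `^ r @[n --> \oo] --> enorm l `^ r.
Proof.
move=> r0 al; have -> : (fun n => enorm (a n) `^ r) =
    (fun y => enorm y `^ r) \o a by [].
by apply: continuous_cvg => //; exact: continuous_enorm_powR.
Qed.

Lemma rate_le_powR (R : realType) (r e : R) (n : nat) : 0 <= r ->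
  n.+1%:R^-1 < e -> rate r n <= e `^ r.
Proof.
move=> r0 ne; rewrite /rate; set t := _^-1.
have t0 : 0 < t by rewrite invr_gt0 ltr0n expn_gt0.
have t1 : t <= 1 by rewrite invf_le1 ?ltr0n ?expn_gt0// ler1n expn_gt0.
have tn : t <= n.+1%:R^-1.
  by rewrite lef_pV2 ?posrE ?ltr0n ?expn_gt0// ler_nat ltnW// ltn_expl.
apply: (@le_trans _ _ (t `^ r)); first by rewrite ler_piMl// powR_ge0.
have te := le_trans tn (ltW ne).
by apply: ge0_ler_powR => //; rewrite nnegrE;
    [exact: ltW|exact: le_trans (ltW t0) te].
Qed.

(** If a sum exceeds m, one may lower its second term strictly and still
    exceed m; the finiteness of x keeps the lowered sum meaningful when y
    is infinite. *)
Lemma real_below_sum (R : realType) (m c : R) (x y : \bar R) :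
  (m%:E < x + y)%E -> (0 <= x)%E -> (x < +oo)%E -> (c%:E <= y)%E ->
  exists b d : R, [/\ x = d%:E, (b%:E < y)%E & m < b + d].
Proof.
move: x y => [d| |] [f| |]//.
  rewrite -EFinD lte_fin => mdf _ _ _; exists ((m - d + f) / 2), d.
  by split => //; [rewrite lte_fin|]; lra.
by move=> _ _ _ _; exists (m - d + 1), d; split => //; [rewrite ltry|lra].
Qed.

Lemma half_lt (R : realFieldType) (d : R) : 0 < d -> d / 2 < d.
Proof. lra. Qed.

(** If the second term of an almost minimal sum does not fall below b, the
    first one has to fall below d by a gap. *)
Lemma gap_le (R : realFieldType) (m b d dk fk e : R) :
  dk + fk <= m + e -> b < fk -> e < (b + d - m) / 2 -> dk <=
      d - (b + d - m) / 2.
Proof. by move=> h1 h2 h3; lra. Qed.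

Lemma midpoint_sum_lt (R : realFieldType) (du fu dv fv dm fm : R) :
  dm <= 2^-1 * du + 2^-1 * dv -> fm < 2^-1 * fu + (1 - 2^-1) * fv ->
  dv + fv = du + fu -> dm + fm < du + fu.
Proof. lra. Qed.

(** Since no value lies below m, the convexity defects of the two terms add
    up to at most e, so that each of them does. *)
Lemma midpoint_defect (R : realFieldType) (m e du fu dv fv dm fm : R) :
  dm <= 2^-1 * du + 2^-1 * dv -> fm <= 2^-1 * fu + (1 - 2^-1) * fv ->
  m <= dm + fm -> du + fu <= m + e -> dv + fv <= m + e ->
  dm + fm <= m + e /\ du + dv <= 2 * (dm + e).
Proof. by split; lra. Qed.

Section minimization.
Context (R : realType) (N : nat).
Context (Omega : set 'rV[R]_N) (oOmega : open Omega).
Context (p q : R) (p1 : 1 < p) (pq : p <= q).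
Local Notation V := ('rV[R]_N * 'rV[R]_N)%type.
Context (omega : V -> R) (omega_adm : admissible_weight Omega omega).
Local Notation mu := (lebesgue_on oOmega).
Local Notation Lq := (LfunType mu (exponent_ge1 p1 pq)).
Hypothesis (Omega_finite : p < q -> (lebesgue_rV N Omega < +oo)%E).
Local Notation lambda := (lebesgue_rV N : {measure set 'rV[R]_N -> \bar R}).
Local Notation lambda2 := (lebesgue_rV N \x lebesgue_rV N)%E.
Local Notation OO := (Omega `*` Omega).
Local Notation D := (nl_dirichlet Omega omega p).

Let q1 : 1 < q. Proof. exact: lt_le_trans pq. Qed.
Let q0 : 0 < q. Proof. exact: lt_trans ltr01 q1. Qed.
Let p0 : 0 < p. Proof. exact: lt_trans ltr01 p1. Qed.

Implicit Types u v : Lq.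

Lemma measurable_Lq u : measurable_fun setT u.
Proof. by have [] := (Lfun_energy mu q0 u).1 (LfunP u). Qed.

Lemma energy_lty u : (\int[mu]_x (`|u x| `^ q)%:E < +oo)%E.
Proof. by have [] := (Lfun_energy mu q0 u).1 (LfunP u). Qed.

(** The only place where a finite measure of Omega is used, when p < q. *)
Lemma Lq_sub_Lp u : (u : _ -> R) \in Lfun mu p%:E.
Proof.
have [pE|pltq] : p = q \/ p < q by apply/predU1P; rewrite -le_eqVlt.
  by have := LfunP u; rewrite [X in Lfun _ X%:E](esym pE).
apply: (@Lfun_subset _ _ _ mu p%:E q%:E) (LfunP u).
- by rewrite lee_fin ltW.
- by rewrite lee_fin ltW.
- rewrite ge0_fin_numE// -[X in (X < _)%E]/(lambda (setT `&` Omega)) setTI.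
  exact: Omega_finite.
- by rewrite lee_fin.
Qed.

Lemma W1p_LqP u : W1p_Lq omega p u <->
  (forall i, exists g, is_nl_partial Omega omega i u g) /\ (D u < +oo)%E.
Proof.
by split=> [[_ ? ?]|[? ?]]; [split|split => //; exact: Lq_sub_Lp].
Qed.

(** The domain of minimization is never empty. *)
Lemma W1p_Lq0 : W1p_Lq omega p (0 : Lq).
Proof.
have z i : is_nl_partial Omega omega i (0 : Lq)
    (fun z => (0 : 'rV[R]_N) ord0 i).
  have := is_nl_partial0 Omega omega i.
  by congr (is_nl_partial _ _ _ _ _); apply/funext => z; rewrite mxE.
apply/W1p_LqP; split => [i|]; first by exists (fun z => (0 : 'rV[R]_N) ord0 i).
rewrite (nl_dirichlet_eq oOmega omega_adm p z) integral0_eq ?ltry// => y _.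
by rewrite (eqP (_ : enorm 0 == 0)) ?enorm_eq0// powR0 ?gt_eqF.
Qed.

(** Written as a convex combination with parameter 1/2 so as to match the
    form of the convexity hypotheses. *)
Definition mid u v : Lq := 2^-1 *: u + (1 - 2^-1) *: v.

Lemma dirichlet_mid_le u v : W1p_Lq omega p u -> W1p_Lq omega p v ->
  (D (mid u v) <= 2^-1%:E * D u + 2^-1%:E * D v)%E.
Proof.
move=> /W1p_LqP[uP _] /W1p_LqP[vP _].
exact: (nl_dirichlet_convex oOmega omega_adm p1 uP vP).
Qed.

Lemma W1p_Lq_mid u v : W1p_Lq omega p u -> W1p_Lq omega p v ->
  W1p_Lq omega p (mid u v).
Proof.
move=> Wu Wv; have [uP Du] := (W1p_LqP u).1 Wu;
    have [vP Dv] := (W1p_LqP v).1 Wv.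
apply/W1p_LqP; split => [i|].
  have := nl_partial_mid oOmega omega_adm (uP i) (vP i).
  by exists (fun z => (2^-1 *:
      (nl_grad Omega omega u z + nl_grad Omega omega v z)) ord0 i).
apply: (le_lt_trans (dirichlet_mid_le Wu Wv)).
have lty (a b : \bar R) : (0 <= a)%E -> (0 <= b)%E -> (a < +oo)%E ->
    (b < +oo)%E ->
    (2^-1%:E * a + 2^-1%:E * b < +oo)%E.
  by move: a b => [a| |] [b| |]//= _ _ _ _; rewrite -!EFinM -EFinD ltry.
exact: (lty _ _ (nl_dirichlet_ge0 _ _ _ _) (nl_dirichlet_ge0 _ _ _ _) Du Dv).
Qed.

Lemma energy_mid u v :
  (\int[mu]_x (`|mid u v x| `^ q)%:E =
      \int[mu]_x (`|2^-1 * (u x + v x)| `^ q)%:E)%E.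
Proof.
apply: eq_integral => x _; congr (`|_| `^ _)%:E.
transitivity (2^-1 * u x + (1 - 2^-1) * v x); first by [].
by move: (u x) (v x) => a b; lra.
Qed.

Context (F : Lq -> \bar R) (c : R).
Hypothesis F_ge : forall u, (c%:E <= F u)%E.

Lemma finite_energy u : W1p_Lq omega p u -> (F u < +oo)%E ->
  exists d f : R, [/\ D u = d%:E, F u = f%:E, 0 <= d & c <= f].
Proof.
move=> /W1p_LqP[_ Du] Fu; have := F_ge u; move: Du Fu.
have := nl_dirichlet_ge0 Omega omega p u.
case: (D u) => [d| |]//; case: (F u) => [f| |]//; rewrite !lee_fin => d0 _ _ cf.
by exists d, f.
Qed.

Lemma I_inf_le u : W1p_Lq omega p u ->
  (I_inf omega p F <= I_functional omega p F u)%E.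
Proof. by move=> Wu; apply: ereal_inf_lbound; exists u. Qed.

Lemma F_lty_of_I u : (I_functional omega p F u < +oo)%E -> (F u < +oo)%E.
Proof.
apply: le_lt_trans; rewrite /I_functional leeDr//; exact: nl_dirichlet_ge0.
Qed.

(** At the midpoint of two distinct minimizers F is strictly below the mean
    of its values and the Dirichlet energy is at most the mean of its
    values, so the midpoint would be strictly better. *)
Lemma minimizer_unique u v : strictly_convex_on_domain F ->
  (I_inf omega p F < +oo)%E ->
  is_minimizer omega p F u -> is_minimizer omega p F v -> u = v %[ae mu].
Proof.
move=> Fs Ioo [Wu Iu] [Wv Iv]; apply: contrapT => uv.
have Fu : (F u < +oo)%E by apply: F_lty_of_I; rewrite Iu.
have Fv : (F v < +oo)%E by apply: F_lty_of_I; rewrite Iv.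
have t01 : (0 < (2^-1 : R) < 1) by lra.
have := Fs u v (2^-1) t01 uv Fu Fv; rewrite -/(mid u v).
have Wm := W1p_Lq_mid Wu Wv; have Dm := dirichlet_mid_le Wu Wv.
have [du [fu [Edu Efu _ _]]] := finite_energy Wu Fu.
have [dv [fv [Edv Efv _ _]]] := finite_energy Wv Fv.
rewrite Efu Efv => Fm.
have Fm' : (F (mid u v) < +oo)%E by apply: (lt_trans Fm);
    rewrite -!EFinM -EFinD ltry.
have [dm [fm [Edm Efm _ _]]] := finite_energy Wm Fm'.
have := I_inf_le Wm; rewrite -{1}Iu; have := Iv; rewrite -Iu.
move: Dm Fm; rewrite /I_functional Edu Edv Efu Efv Edm Efm.
rewrite -!EFinM -!EFinD lee_fin lte_fin => Dm Fm [E]; rewrite lee_fin => Im.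
by have := midpoint_sum_lt Dm Fm E; rewrite ltNge Im.
Qed.

Hypotheses (F_convex : convex_functional F) (F_lsc : norm_lsc F)
  (F_coercive : coercive_functional F).
Context (m : R) (I_infE : I_inf omega p F = m%:E).
Local Notation I := (I_functional omega p F).
Local Notation grad := (nl_grad Omega omega).

Definition near_minimizers (n : nat) : set Lq :=
  [set u | W1p_Lq omega p u /\ (I u <= (m + n.+1%:R^-1)%:E)%E].
Local Notation C := near_minimizers.

Lemma near_minimizers_finite n u : C n u ->
  exists d f : R, [/\ D u = d%:E, F u = f%:E, 0 <= d, c <= f & d + f <= m +
      n.+1%:R^-1].
Proof.
move=> [Wu Iu]; have Fu : (F u < +oo)%E by apply: F_lty_of_I;
    exact: le_lt_trans Iu (ltry _).
have [d [f [Ed Ef d0 cf]]] := finite_energy Wu Fu.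
by exists d, f; split => //; move: Iu;
    rewrite /I_functional Ed Ef -EFinD lee_fin.
Qed.

Lemma near_minimizers_neq0 n : C n !=set0.
Proof.
have n0 : 0 < n.+1%:R^-1 :> R by rewrite invr_gt0.
have Ifin : I_inf omega p F \is a fin_num by rewrite I_infE.
have [_ [u Wu <-] /ltW h] := lb_ereal_inf_adherent n0 Ifin.
by exists u; split=> //; rewrite EFinD -I_infE.
Qed.

Lemma near_minimizers_sub n k : (n <= k)%N -> C k `<=` C n.
Proof.
move=> nk u [Wu Iu]; split => //; apply: (le_trans Iu).
by rewrite lee_fin lerD2l lef_pV2 ?posrE// ler_nat ltnS.
Qed.

(** Near-minimizers are stable under midpoints, by convexity; and since the
    midpoint cannot go below the infimum, the convexity defect of the
    Dirichlet energy alone is at most the tolerance. *)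
Lemma near_minimizers_mid n u v : C n u -> C n v ->
  C n (mid u v) /\ (D u + D v <= 2%:E * (D (mid u v) + (n.+1%:R^-1)%:E))%E.
Proof.
move=> Cu Cv; have [Wu _] := Cu; have [Wv _] := Cv.
have [du [fu [Edu Efu _ _ Iu]]] := near_minimizers_finite Cu.
have [dv [fv [Edv Efv _ _ Iv]]] := near_minimizers_finite Cv.
have Wm := W1p_Lq_mid Wu Wv; have Dm := dirichlet_mid_le Wu Wv.
have t01 : (0 <= (2^-1 : R) <= 1) by lra.
have Fm : (F (mid u v) <= 2^-1%:E * F u + (1 - 2^-1)%:E * F v)%E
    by exact: F_convex.
rewrite Efu Efv -!EFinM -EFinD in Fm.
have [dm [fm [Edm Efm _ _]]] := finite_energy Wm (le_lt_trans Fm (ltry _)).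
have := I_inf_le Wm; rewrite I_infE /I_functional Edm Efm -EFinD lee_fin => Im.
rewrite Efm lee_fin in Fm; rewrite Edu Edv Edm -!EFinM -EFinD lee_fin in Dm.
have [Im' Dm'] := midpoint_defect Dm Fm Im Iu Iv.
split; last by rewrite Edu Edv -!EFinD -EFinM lee_fin.
by split => //; rewrite /I_functional Edm Efm -EFinD lee_fin.
Qed.

(** Coercivity of F bounds the q-energy, and the lower bound of F bounds
    the Dirichlet energy. *)
Lemma near_minimizers_bounded : exists M, 0 < M /\ forall u, C 0%N u ->
  (\int[mu]_x (`|u x| `^ q)%:E <= M%:E)%E /\ (D u <= M%:E)%E.
Proof.
have [K HK] := F_coercive (m + 1).
pose k := Num.max K 0; have k0 : 0 <= k by rewrite le_max lexx orbT.
exists (k `^ q + (`|m + 1 - c| + 1)); split.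
  by rewrite ltr_wpDl ?powR_ge0// ltr_wpDl.
move=> u Cu; have [d [f [Ed Ef d0 cf]]] := near_minimizers_finite Cu.
rewrite invr1 => Iu; split.
  apply: (@le_trans _ _ (k `^ q)%:E); last by rewrite lee_fin lerDl addr_ge0.
  rewrite -(Lnorm_le mu q0)// leNgt; apply/negP => kN.
  have : ((m + 1)%:E < F u)%E.
    by apply: HK; apply: le_lt_trans kN; rewrite lee_fin le_max lexx.
  rewrite Ef lte_fin => mf.
  by have := le_lt_trans Iu mf; rewrite ltNge lerDr d0.
rewrite Ed lee_fin; apply: (@le_trans _ _ (m + 1 - c)).
  by rewrite lerBrDr (le_trans _ Iu)// lerD2l.
by rewrite (le_trans (ler_norm _))// addrCA lerDl addr_ge0 ?powR_ge0.
Qed.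

Lemma W1p_Lq_measurable_grad u i : W1p_Lq omega p u ->
  measurable_fun OO (fun z => grad u z ord0 i).
Proof. by move=> /W1p_LqP[uP _]; exact: measurable_nl_grad (uP i). Qed.

(** Near-minimizers that nearly minimize the q-energy. Midpoints are again
    near-minimizers, so nested_minimizing and uniform convexity make the
    functions Cauchy in L^q; the defect bound of near_minimizers_mid and
    uniform convexity make the gradients Cauchy in L^p. A subsequence then
    has the prescribed rates. *)
Lemma cauchy_minimizing : exists U : nat -> Lq, (forall n, C n (U n)) /\
  forall n k, (n <= k)%N ->
    (\int[mu]_x (`|U n x - U k x| `^ q)%:E <= (rate q n)%:E)%E /\
    (\int[lambda2]_(z in OO) (enorm (grad (U n) z - grad (U k) z) `^ p)%:E <=
        (rate p n)%:E)%E.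
Proof.
have [M [M0 bounded]] := near_minimizers_bounded.
pose phi u := fine (\int[mu]_x (`|u x| `^ q)%:E)%E.
have phiE u : ((phi u)%:E = \int[mu]_x (`|u x| `^ q)%:E)%E.
  rewrite fineK// ge0_fin_numE ?energy_lty//.
  by apply: integral_ge0 => x _; rewrite lee_fin powR_ge0.
have phi0 u : 0 <= phi u.
  by rewrite -lee_fin phiE; apply: integral_ge0 => x _;
      rewrite lee_fin powR_ge0.
have [u C0n|x [Cx xmin]] := nested_minimizing (phi := phi) (B := M)
    near_minimizers_neq0 near_minimizers_sub.
  by rewrite phi0 -lee_fin phiE; have [] := bounded u C0n.
have rate_gt0 r n : 0 < rate r n :> R.
  by rewrite /rate mulr_gt0 ?powR_gt0 ?invr_gt0 ?ltr0n ?expn_gt0.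
have C0x k : C 0%N (x k) by exact: near_minimizers_sub (Cx k).
have mO2 : measurable OO by apply: open_measurable_prV; exact: open_setX.
have key n : exists N0, forall k l, (N0 <= k)%N -> (k <= l)%N ->
    (\int[mu]_y (`|x k y - x l y| `^ q)%:E <= (rate q n)%:E)%E /\
    (\int[lambda2]_(z in OO) (enorm (grad (x k) z - grad (x l) z) `^ p)%:E <=
        (rate p n)%:E)%E.
  have [dq dq0 Hq] := Lp_uniformly_convex_scalar mu measurableT q1 M0
      (rate_gt0 q n).
  have [dp dp0 Hp] := @Lp_uniformly_convex _ _ _ lambda2 _ mO2 N _ _ _ p1 M0
      (rate_gt0 p n).
  have [N1 HN1] := xmin _ dq0.
  have [N2 _ HN2] := near_infty_natSinv_lt (PosNum dp0).
  exists (maxn N1 N2) => k l; rewrite geq_max => /andP[k1 k2] kl.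
  have Ckl : C k (x l) by exact: near_minimizers_sub (Cx l).
  have [Cm Dm] := near_minimizers_mid (Cx k) Ckl.
  have [Wk _] := Cx k; have [Wl _] := Cx l; split.
    apply: Hq; [exact: measurable_Lq|exact: measurable_Lq|exact:
        (bounded _ (C0x k)).1|
      exact: (bounded _ (C0x l)).1|].
    rewrite -energy_mid -!phiE -!EFinD -EFinM lee_fin.
    exact: HN1 k1 kl _ Cm.
  apply: Hp.
  - by move=> i; exact: W1p_Lq_measurable_grad.
  - by move=> i; exact: W1p_Lq_measurable_grad.
  - by rewrite -nl_dirichletE; exact: (bounded _ (C0x k)).2.
  - by rewrite -nl_dirichletE; exact: (bounded _ (C0x l)).2.
  have transport (a a' b b' e e' : \bar R) : a = a' -> b = b' -> e = e' ->
      (a + b <= 2%:E * (e + dp%:E))%E -> (a' + b' <= 2%:E * (e' + dp%:E))%E.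
    by move=> <- <- <-.
  apply: (transport _ _ _ _ _ _ (nl_dirichletE Omega omega p (x k))
    (nl_dirichletE Omega omega p (x l))
    (nl_dirichlet_mid oOmega omega_adm p ((W1p_LqP _).1 Wk).1
        ((W1p_LqP _).1 Wl).1)).
  apply: (le_trans Dm); apply: lee_wpmul2l; first by rewrite lee_fin.
  by apply: leeD2l; rewrite lee_fin ltW//; exact: HN2.
have [N0 HN0] := choice key.
have [sigma [smono sge sN0]] := monotone_reindexing N0.
exists (x \o sigma); split => [n|n k nk].
  exact: near_minimizers_sub (sge n) _ (Cx _).
by apply: HN0; [exact: sN0|exact: smono].
Qed.

Lemma integral_lebesgue_on (f : 'rV[R]_N -> R) : measurable_fun setT f ->
  (forall x, 0 <= f x) ->
  (\int[mu]_x (f x)%:E = \int[lambda]_(x in Omega) (f x)%:E)%E.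
Proof.
move=> mf f0; apply: (@ge0_integral_mrestr _ _ _ lambda Omega _ (EFin \o f)).
  exact/measurable_EFinP.
by move=> x; rewrite lee_fin.
Qed.

(** The limit u of the minimizing sequence. Its gradient is the limit of
    the gradients by is_nl_partial_closed, so the Dirichlet energy is lower
    semicontinuous along the sequence by Fatou's lemma. If I(u) > m, there
    are d = D(u) and b < F(u) with b + d > m; lower semicontinuity of F
    gives F(U n) > b for large n, which forces D(U n) below d by a fixed
    gap and contradicts Fatou's lemma. *)
Lemma minimizer_exists_finite : exists u, is_minimizer omega p F u.
Proof.
have [U [CU UR]] := cauchy_minimizing.
have [M [M0 bounded]] := near_minimizers_bounded.
have C0U n : C 0%N (U n) by exact: near_minimizers_sub (CU n).
have WU n : W1p_Lq omega p (U n) by have [] := CU n.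
have mO2 : measurable OO by apply: open_measurable_prV; exact: open_setX.
have [u [u_cvg u_rate]] : exists u : Lq,
    {ae mu, forall x, setT x -> (fun n => U n x) @ \oo --> u x} /\
    forall n, (\int[mu]_x (`|U n x - u x| `^ q)%:E <= (rate q n)%:E)%E.
  have [n|n k nk|u0 [mu0 u0_cvg u0_rate]] :=
      @Lp_rapid_cauchy_cvg _ _ _ mu setT measurableT q (fun n x => U n x) q0.
  - exact: measurable_Lq.
  - exact: (UR n k nk).1.
  have u0M : (\int[mu]_x (`|u0 x| `^ q)%:E <= M%:E)%E.
    apply: (@fatou_le _ _ _ mu setT measurableT
        (fun n x => `|U n x| `^ q) _ _ 0).
    - by move=> n; apply: measurable_norm_powR; exact: measurable_Lq.
    - exact: measurable_norm_powR.
    - by move=> n x; exact: powR_ge0.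
    - by move=> x; exact: powR_ge0.
    - apply: filterS u0_cvg => x h _.
      by apply: cvg_norm_powR => //; exact: h.
    - by move=> n _; exact: (bounded _ (C0U n)).1.
  have u0L : u0 \in Lfun mu q%:E.
    by apply/(Lfun_energy mu q0); split => //; exact: le_lt_trans u0M (ltry _).
  by exists (Lfun_Sub (exponent_ge1 p1 pq) u0L).
have gradU n i : is_nl_partial Omega omega i (U n)
    (fun z => grad (U n) z ord0 i).
  have [UP _] := (W1p_LqP (U n)).1 (WU n).
  have := nl_partialP (UP i); congr (is_nl_partial _ _ _ _ _).
  by apply/funext => z; rewrite mxE.
have mgradU n i : measurable_fun OO (fun z => grad (U n) z ord0 i).
  exact: W1p_Lq_measurable_grad.
have DU n : (\int[lambda2]_(z in OO) (enorm (grad (U n) z) `^ p)%:E <= M%:E)%E.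
  by rewrite -nl_dirichletE; exact: (bounded _ (C0U n)).2.
have /choice[g gP] : forall i : 'I_N, exists g : V -> R,
    [/\ measurable_fun OO g,
        {ae lambda2, forall z, OO z ->
          (fun n => grad (U n) z ord0 i) @ \oo --> g z} &
        is_nl_partial Omega omega i u g].
  move=> i; have [n|n k nk|g [mg g_cvg g_rate]] :=
      @Lp_rapid_cauchy_cvg _ _ _ lambda2 OO mO2 p
          (fun n z => grad (U n) z ord0 i) p0.
  - exact: mgradU.
  - apply: le_trans (UR n k nk).2; apply: ge0_le_integral_EFin => //.
    + by apply: measurable_norm_powR; exact: measurable_funB.
    + apply: measurable_enorm_powR => // j.
      rewrite (_ : (fun z => _) =
          (fun z => grad (U n) z ord0 j - grad (U k) z ord0 j)).
        exact: measurable_funB.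
      by apply/funext => z; rewrite !mxE.
    + move=> z _; rewrite powR_ge0/=; apply: ge0_ler_powR;
        rewrite ?nnegrE ?enorm_ge0 ?(ltW p0)//.
      have -> : grad (U n) z ord0 i - grad (U k) z ord0 i =
          (grad (U n) z - grad (U k) z) ord0 i.
        by rewrite !mxE.
      exact: coord_le_enorm.
  have gM : (\int[lambda2]_(z in OO) (`|g z| `^ p)%:E <= M%:E)%E.
    apply: (@fatou_le _ _ _ lambda2 OO mO2
        (fun n z => `|grad (U n) z ord0 i| `^ p) _ _ 0).
    - by move=> n; exact: measurable_norm_powR.
    - exact: measurable_norm_powR.
    - by move=> n z; exact: powR_ge0.
    - by move=> z; exact: powR_ge0.
    - apply: filterS g_cvg => z h OOz.
      by apply: cvg_norm_powR => //; exact: h.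
    - move=> n _; apply: le_trans (DU n); apply: ge0_le_integral_EFin => //.
      + exact: measurable_norm_powR.
      + exact: measurable_enorm_powR.
      + move=> z _; rewrite powR_ge0/=; apply: ge0_ler_powR;
          rewrite ?nnegrE ?enorm_ge0 ?(ltW p0)//.
        exact: coord_le_enorm.
  exists g; split => //.
  apply: (@is_nl_partial_closed _ _ _ oOmega _ omega_adm i p q
      (fun n x => U n x)
    (fun n z => grad (U n) z ord0 i)) => //.
  - exact: ltW.
  - exact: ltW.
  - by apply: measurable_funTS; exact: measurable_Lq.
  - rewrite -(integral_lebesgue_on (f := fun x => `|u x| `^ q)).
    + exact: energy_lty.
    + by apply: measurable_norm_powR; exact: measurable_Lq.
    + by move=> x; exact: powR_ge0.
  - exact: le_lt_trans gM (ltry _).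
  - move=> n; rewrite -(integral_lebesgue_on
      (f := fun x => `|U n x - u x| `^ q)).
    + exact: u_rate.
    + by apply: measurable_norm_powR; apply: measurable_funB;
        exact: measurable_Lq.
    + by move=> x; exact: powR_ge0.
pose G z : 'rV[R]_N := \row_i g i z.
have GE i : (fun z => G z ord0 i) = g i by apply/funext => z; rewrite mxE.
have mG i : measurable_fun OO (fun z => G z ord0 i) by rewrite GE;
    have [] := gP i.
have Gz i z : G z ord0 i = g i z by rewrite mxE.
clearbody G.
have DE : D u = (\int[lambda2]_(z in OO) (enorm (G z) `^ p)%:E)%E.
  apply: (nl_dirichlet_eq oOmega omega_adm p) => i; rewrite GE.
  by have [] := gP i.
have D_lsc (b : \bar R) n : (forall k, (n <= k)%N -> D (U k) <= b)%E ->
    (D u <= b)%E.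
  move=> Db; rewrite DE.
  apply: (@fatou_le _ _ _ lambda2 OO mO2 (fun n z => enorm (grad (U n) z) `^ p)
      _ _ n).
  - by move=> k; exact: measurable_enorm_powR.
  - exact: measurable_enorm_powR.
  - by move=> k z; exact: powR_ge0.
  - by move=> z; exact: powR_ge0.
  - have : {ae lambda2, forall z i, OO z ->
      (fun n => grad (U n) z ord0 i) @ \oo --> g i z}.
      by apply: filter_forall => i; have [] := gP i.
    apply: filterS => z h OOz.
    have Gcvg : (fun n => grad (U n) z) @ \oo --> G z.
      by apply: cvg_coord_rV => i; rewrite Gz; exact: h.
    exact: cvg_enorm_powR.
  - by move=> k nk; rewrite -nl_dirichletE; exact: Db.
have Du : (D u < +oo)%E.
  apply: (@le_lt_trans _ _ M%:E); last exact: ltry.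
  by apply: (D_lsc _ 0) => k _; exact: (bounded _ (C0U k)).2.
have Wu : W1p_Lq omega p u.
  apply/W1p_LqP; split; last exact: Du.
  by move=> i; have [_ _ gi] := gP i; exists (g i).
exists u; split; first exact: Wu.
apply/eqP; rewrite eq_le (I_inf_le Wu) andbT I_infE leNgt.
apply/negP => Im.
have [b [d [Ed Fb bd]]] : exists b d : R,
    [/\ D u = d%:E, (b%:E < F u)%E & m < b + d].
  exact: (real_below_sum Im (nl_dirichlet_ge0 Omega omega p u) Du (F_ge u)).
have [delta delta0 Hdelta] := F_lsc Fb.
have delta20 : 0 < delta / 2 by rewrite divr_gt0.
have F_near : \forall n \near \oo, (b%:E < F (U n))%E.
  have := near_infty_natSinv_lt (PosNum delta20); apply: filterS => n /= nd.
  apply: Hdelta; apply: (@le_lt_trans _ _ (delta / 2)%:E); last first.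
    by rewrite lte_fin half_lt.
  rewrite (Lnorm_le mu q0 _ (ltW delta20)); apply: le_trans (u_rate n) _.
  rewrite lee_fin; exact: rate_le_powR (ltW q0) nd.
have gap0 : 0 < (b + d - m) / 2.
  apply: divr_gt0; [rewrite subr_gt0; exact: bd|exact: ltr0Sn].
have [n1 _ Fn] := F_near.
have [n2 _ Hn] := near_infty_natSinv_lt (PosNum gap0).
have : (D u <= (d - (b + d - m) / 2)%:E)%E.
  apply: (D_lsc _ (maxn n1 n2)) => k; rewrite geq_max => /andP[k1 k2].
  have [dk [fk [Edk Efk _ _ Ik]]] := near_minimizers_finite (CU k).
  have := Fn k k1; rewrite /= Efk Edk lte_fin lee_fin => bf.
  have : k.+1%:R^-1 < (b + d - m) / 2 by exact: Hn.
  exact: gap_le Ik bf.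
by rewrite Ed lee_fin lerDl oppr_ge0 leNgt gap0.
Qed.

End minimization.

Lemma half_in_unit (R : realFieldType) : 0 < (2^-1 : R) < 1.
Proof. lra. Qed.

Theorem theorem1p8 (R : realType) (N : nat)
  (Omega : set 'rV[R]_N) (oOmega : open Omega) (Omega_neq0 : Omega !=set0)
  (p q : R) (p1 : 1 < p) (pq : p <= q)
  (omega : 'rV[R]_N * 'rV[R]_N -> R)
  (omega_adm : admissible_weight Omega omega)
  (F : LfunType (lebesgue_on oOmega) (exponent_ge1 p1 pq) -> \bar R)
  (F_ae : ae_compatible F)
  (F_proper : proper_functional F)
  (F_bounded_below : bounded_below F)
  (F_convex : convex_functional F)
  (F_lsc : norm_lsc F)
  (F_coercive : coercive_functional F)
  (Omega_finite : p < q -> (lebesgue_rV N Omega < +oo)%E) :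
  [/\ exists u, is_minimizer omega p F u,
      strictly_convex_functional F ->
        forall u v, is_minimizer omega p F u -> is_minimizer omega p F v ->
          u = v %[ae lebesgue_on oOmega] &
      strictly_convex_on_domain F -> (I_inf omega p F < +oo)%E ->
        forall u v, is_minimizer omega p F u -> is_minimizer omega p F v ->
          u = v %[ae lebesgue_on oOmega]].

Proof.
have [c F_ge] := F_bounded_below.
have unique : strictly_convex_on_domain F -> (I_inf omega p F < +oo)%E ->
    forall u v, is_minimizer omega p F u -> is_minimizer omega p F v ->
    u = v %[ae lebesgue_on oOmega].
  by move=> Fs Ioo u v; exact:
      (minimizer_unique omega_adm Omega_finite F_ge Fs Ioo).
split.
- have [Ioo|] := ltP (I_inf omega p F) +oo%E; last first.
    (* If I is +oo on its whole domain, every point of the domain is a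
       minimizer. *)
    rewrite leye_eq => /eqP Ioo; exists 0.
    have W0 := W1p_Lq0 oOmega p1 pq omega_adm Omega_finite; split;
        first exact: W0.
    by apply/eqP; rewrite eq_le (I_inf_le F W0) Ioo leey.
  have I_fin : I_inf omega p F \is a fin_num.
    rewrite fin_numElt Ioo andbT; apply: (@lt_le_trans _ _ c%:E);
        first exact: ltNyr.
    apply: le_ereal_inf_tmp => _ [u _ <-]; rewrite -[leLHS]add0e.
    by apply: leeD; [exact: nl_dirichlet_ge0|exact: F_ge].
  exact: (minimizer_exists_finite omega_adm Omega_finite F_ge F_convex F_lsc
      F_coercive
    (esym (fineK I_fin))).
- move=> Fs u v mu mv; apply: contrapT => uv.
  (* Strict convexity at u and v forces F to be finite at their midpoint,
     so the infimum is finite; uniqueness then only needs strict convexity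
     on the domain. *)
  have Fmid := Fs u v (2^-1 : R) (half_in_unit R) uv.
  have [Wu _] := mu; have [Wv _] := mv.
  have Wm := W1p_Lq_mid omega_adm Omega_finite Wu Wv.
  have Ioo : (I_inf omega p F < +oo)%E.
    apply: (le_lt_trans (I_inf_le F Wm)).
    have [_ _ Dm] := Wm; apply: lte_add_pinfty; first exact: Dm.
    exact: lt_le_trans Fmid (leey _).
  by apply: uv; apply: unique => // u' v' t t01 uv' _ _; exact: Fs.
- exact: unique.
Qed.
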